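(* Let $X=\mathbb{P}^1\times\mathbb{P}^1$, let $d,e\geq2$, $L=\mathcal{O}_X(d,e)$, and let $F\in H^0(X,L)$ be such that $Z=\{F=0\}$ is a smooth curve. Then: (1) The base divisor of the linear system $|J_{d-1,e|Z}|$ on $Z$ coincides with the ramification divisor of the second projection $Z\hookrightarrow X=\mathbb{P}^1\times\mathbb{P}^1\xrightarrow{\pi_2}\mathbb{P}^1$, and after removing the base points $|J_{d-1,e|Z}|$ induces the projection of $Z$ onto the first factor. (2) The restricted linear system $|J_{d,e|Z}|$ is base point free and the induced morphism $Z\to|J_{d,e|Z}|^\vee$ is birational onto its image.
   Context: Work over $\mathbb{C}$. Let $(x_0:x_1)$, $(y_0:y_1)$ be homogeneous coordinates on the two factors and let $S=\mathbb{C}[x_0,x_1,y_0,y_1]$ be bigraded by $\deg x_i=(1,0)$, $\deg y_i=(0,1)$; $S_{a,b}=H^0(X,\mathcal{O}_X(a,b))$ is the bidegree $(a,b)$ part. $J_{a,b}\subseteq S_{a,b}$ is the generalized Jacobian ideal of $F$ in degree $\mathcal{O}_X(a,b)$: $J_{a,b}=\operatorname{im}(dF\colon H^0(\Sigma_L(a-d,b-e))\to H^0(\mathcal{O}_X(a,b)))$, where $\Sigma_L$ is the bundle of first-order differential operators on sections of $L$ and $dF\colon\Sigma_L\to L$ is $D\mapsto D(F)$. It equals the bidegree $(a,b)$ part of the ideal generated by $\frac{\partial F}{\partial x_0},\frac{\partial F}{\partial x_1},\frac{\partial F}{\partial y_0},\frac{\partial F}{\partial y_1}$. In particular $J_{d-1,e}$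 is spanned by $\frac{\partial F}{\partial x_0},\frac{\partial F}{\partial x_1}$, and $J_{d,e}$ is spanned by all $x_i\frac{\partial F}{\partial x_j}$ and $y_i\frac{\partial F}{\partial y_j}$, $i,j\in\{0,1\}$. $|J_{a,b|Z}|$ denotes the linear subsystem of $|\mathcal{O}_Z(a,b)|$ given by the image of $J_{a,b}$ under restriction $H^0(X,\mathcal{O}_X(a,b))\to H^0(Z,\mathcal{O}_Z(a,b))$. ''Induces the projection'' is understood up to the choice of coordinates on the target $\mathbb{P}^1$. *)

(* Defs.v *)
From mathcomp Require Import all_boot all_order all_algebra.
From mathcomp Require Import mpoly.

Set Implicit Arguments.
Unset Strict Implicit.
Unset Printing Implicit Defensive.

Import GRing.Theory.
Local Open Scope ring_scope.

(* Points of projective spaces are represented by nonzero row vectors of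
   homogeneous coordinates, compared by [proj_eq]; a point of P^1 x P^1 is a
   pair of such.  The bigraded ring S = K[x_0, x_1, y_0, y_1] is
   {mpoly K[2 + 2]}, with x_i and y_i the variables of index [xi i], [yi i]. *)

Section Defs.

Variable K : closedFieldType.

Local Notation S := {mpoly K[2 + 2]}.
Local Notation pt := ('rV[K]_2 * 'rV[K]_2)%type.

Definition xi (i : 'I_2) : 'I_(2 + 2) := lshift 2 i.
Definition yi (i : 'I_2) : 'I_(2 + 2) := rshift 2 i.

Definition proj_eq (n : nat) (u v : 'rV[K]_n) : Prop :=
  exists c : K, c != 0 /\ v = c *: u.

Definition pt_eq (p q : pt) : Prop := proj_eq p.1 q.1 /\ proj_eq p.2 q.2.

Definition bihomog (a b : nat) (s : S) : Prop :=
  forall m : 'X_{1..(2 + 2)}, m \in msupp s ->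
    (\sum_(i < 2) m (xi i))%N = a /\ (\sum_(i < 2) m (yi i))%N = b.

Definition evp (s : S) (p : pt) : K := s.@[row_mx p.1 p.2 ord0].

Definition onX (p : pt) : Prop := p.1 != 0 /\ p.2 != 0.

Definition onZ (F : S) (p : pt) : Prop := onX p /\ evp F p = 0.

(* Jacobian criterion in each of the four charts x_i = y_j = 1, where the
   affine coordinates are x_(1-i) and y_(1-j).  Smoothness excludes F = 0; it
   is not assumed, but follows for d, e > 0, that Z is irreducible. *)
Definition smooth (F : S) : Prop :=
  forall (i j : 'I_2) (p : pt), p.1 ord0 i = 1 -> p.2 ord0 j = 1 ->
    evp F p = 0 ->
    evp F^`M(xi (rev_ord i)) p != 0 \/ evp F^`M(yi (rev_ord j)) p != 0.

(* The restriction H^0(X, O(a,b)) -> H^0(Z, O_Z(a,b)) has kernel the multiples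
   of F, so [eq_on F s t] says that s and t have the same restriction to Z. *)
Definition eq_on (F s t : S) : Prop := exists q : S, s - t = q * F.

(* The image of dF : H^0(Sigma_L(a-d, b-e)) -> H^0(O(a,b)), expressed in S. *)
Definition jacobian (F : S) (a b : nat) (s : S) : Prop :=
  bihomog a b s /\
  exists c : 'I_(2 + 2) -> S, s = \sum_(i < 2 + 2) c i * F^`M(i).

(* The linear form in the variables z_0, z_1 vanishing at the point v of P^1. *)
Definition line (z : 'I_2 -> 'I_(2 + 2)) (v : 'rV[K]_2) : S :=
  v ord0 ord_max *: 'X_(z ord0) - v ord0 ord0 *: 'X_(z ord_max).

(* [ord_ge F p s k] : the germ of s at p lies in m_p^k O_Z(a,b)_p.  The maximal
   ideal of O_(X,p) is the homogeneous localization of (lx, ly) with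
   lx = line xi p.1 and ly = line yi p.2, so its k-th power is generated by the
   lx^i ly^(k-i), and O_(Z,p) is the quotient by F.  The factor h, nonzero at
   p, clears the denominators. *)
Definition ord_ge (F : S) (p : pt) (s : S) (k : nat) : Prop :=
  exists (h : S) (c : 'I_k.+1 -> S),
    [/\ exists a b, bihomog a b h,
        evp h p != 0
      & eq_on F (h * s)
          (\sum_(i < k.+1) c i * (line xi p.1 ^+ i * line yi p.2 ^+ (k - i)))].

(* The valuation of the discrete valuation ring O_(Z,p). *)
Definition ord_is (F : S) (p : pt) (s : S) (k : nat) : Prop :=
  ord_ge F p s k /\ ~ ord_ge F p s k.+1.

(* Effective divisors on Z, given by their multiplicities at the points of Z;
   values off Z are irrelevant. *)
Definition is_divisor (F : S) (D : pt -> nat) : Prop :=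
  (forall p q : pt, onZ F p -> onZ F q -> pt_eq p q -> D p = D q) /\
  exists supp : seq pt, forall p : pt, onZ F p -> D p <> 0%N ->
    exists2 q : pt, q \in supp & pt_eq p q.

(* Base divisor of |V|_Z| : at each point the minimum of the orders of the
   sections in V. *)
Definition is_base_divisor (F : S) (V : S -> Prop) (D : pt -> nat) : Prop :=
  is_divisor F D /\
  forall p : pt, onZ F p ->
    (forall s : S, V s -> ord_ge F p s (D p)) /\
    (exists2 s : S, V s & ord_is F p s (D p)).

(* Ramification divisor of the second projection : sum of (e_p - 1) p with
   e_p the order at p of the pullback of a local parameter of P^1. *)
Definition is_ramification_divisor2 (F : S) (D : pt -> nat) : Prop :=
  is_divisor F D /\
  forall p : pt, onZ F p ->
    exists2 e : nat, ord_is F p (line yi p.2) e & D p = (e - 1)%N.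

Definition base_point_free (F : S) (V : S -> Prop) : Prop :=
  forall p : pt, onZ F p -> exists2 s : S, V s & evp s p != 0.

Definition is_basis_on (F : S) (V : S -> Prop) (n : nat) (s : 'I_n -> S)
  : Prop :=
  [/\ forall i : 'I_n, V (s i),
      forall t : S, V t ->
        exists c : 'I_n -> K, eq_on F t (\sum_(i < n) c i *: s i)
    & forall c : 'I_n -> K, eq_on F (\sum_(i < n) c i *: s i) 0 ->
        forall i : 'I_n, c i = 0].

Definition phi (n : nat) (s : 'I_n -> S) (p : pt) : 'rV[K]_n :=
  \row_(i < n) evp (s i) p.

(* v is the image of p under the morphism given by the sections s_i after
   removing their base divisor D : divide the s_i by a local equation t of D
   near p, then evaluate the quotients u_i at p. *)
Definition moving_image (F : S) (D : pt -> nat) (n : nat) (s : 'I_n -> S)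
    (p : pt) (v : 'rV[K]_n) : Prop :=
  exists (h t : S) (u : 'I_n -> S),
    [/\ (exists a b, bihomog a b h) /\ evp h p != 0,
        (exists a b, bihomog a b t) /\ ord_is F p t (D p),
        exists a b, forall i : 'I_n, bihomog a b (u i),
        forall i : 'I_n, eq_on F (h * s i) (t * u i)
      & phi u p != 0 /\ proj_eq (phi u p) v].

(* Removing base points, |V|_Z| induces the first projection for a suitable
   basis of V|_Z, i.e. for a suitable choice of coordinates on the target. *)
Definition induces_projection1 (F : S) (V : S -> Prop) : Prop :=
  exists (D : pt -> nat) (s : 'I_2 -> S),
    [/\ is_base_divisor F V D, is_basis_on F V s
      & forall p : pt, onZ F p -> moving_image F D s p p.1].

(* U is Zariski open and dense in A, where the closed subsets of T are the
   common zero loci of families of functions satisfying [form]. *)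
Definition dense_open (T : Type) (form : (T -> K) -> Prop) (A U : T -> Prop)
  : Prop :=
  (exists2 P : (T -> K) -> Prop, (forall f, P f -> form f) &
     forall p : T, U p <-> A p /\ exists2 f, P f & f p != 0) /\
  (forall f : T -> K, form f -> (forall p, U p -> f p = 0) ->
     forall p, A p -> f p = 0).

Definition formX (f : pt -> K) : Prop :=
  exists (a b : nat) (g : S), bihomog a b g /\ forall p, f p = evp g p.

Definition formP (n : nat) (f : 'rV[K]_n -> K) : Prop :=
  exists (k : nat) (g : {mpoly K[n]}),
    g \is k.-homog /\ forall v, f v = g.@[v ord0].

Definition image_of_Z (F : S) (n : nat) (s : 'I_n -> S) (v : 'rV[K]_n) : Prop :=
  exists2 p : pt, onZ F p & proj_eq (phi s p) v.

Definition eval_pair (n : nat) (A : 'I_2 -> {mpoly K[n]}) (v : 'rV[K]_n)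
  : 'rV[K]_2 :=
  \row_(i < 2) (A i).@[v ord0].

(* phi s restricts to an isomorphism from a dense open U of Z onto a dense open
   V of the image of Z.  The inverse V -> U is a morphism : near every point
   of V both of its components are given by pairs of forms of equal degree. *)
Definition birational_onto_image (F : S) (n : nat) (s : 'I_n -> S) : Prop :=
  exists (U : pt -> Prop) (V : 'rV[K]_n -> Prop),
    [/\ dense_open formX (onZ F) U,
        dense_open (@formP n) (image_of_Z F s) V,
        forall p : pt, U p -> V (phi s p),
        forall v : 'rV[K]_n, V v ->
          exists2 p : pt, U p & proj_eq (phi s p) v
      & forall p : pt, U p ->
          exists (k l : nat) (A B : 'I_2 -> {mpoly K[n]}),
            [/\ forall i, A i \is k.-homog,
                forall i, B i \is l.-homog,
                eval_pair A (phi s p) != 0,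
                eval_pair B (phi s p) != 0
              & forall q : pt, U q ->
                  eval_pair A (phi s q) != 0 -> eval_pair B (phi s q) != 0 ->
                  pt_eq (eval_pair A (phi s q), eval_pair B (phi s q)) q]].

End Defs.

(* Main.v *)
Require Import Defs.
From HB Require Import structures.
From mathcomp Require Import all_boot all_order all_algebra.
From mathcomp Require Import mpoly complex reals ring zify separable.
From Stdlib Require Import Classical IndefiniteDescription.

(* At a point p of Z choose a chart with affine coordinates x', y'
   and let delta = F_y' d_x' - F_x' d_y', a derivation of S that kills F and the
   two other coordinates.  As Z is smooth at p, delta generates the derivations
   of O_(Z,p), so in characteristic 0 the order of s at p is the least k with
   (delta^k s)(p) <> 0.  If ly is the linear form in y vanishing at p, then
   delta ly is F_x' up to a constant, so ord F_x' = ord ly - 1: the base divisor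
   is the ramification divisor.  On Z Euler's relation reads
   x_0 F_x0 + x_1 F_x1 = 0, so that (F_x1 : -F_x0) = (x_0 : x_1) wherever the
   left side is defined, and likewise for y.  Hence the sections x_k F_xi and
   y_l F_yj of J_(d,e) recover both coordinates of every point of Z at which
   neither projection ramifies.  There are only finitely many other points, as
   a smooth F is squarefree in either variable, and Z has no isolated points. *)

Set Implicit Arguments.
Unset Strict Implicit.
Unset Printing Implicit Defensive.

Import GRing.Theory.
Local Open Scope ring_scope.

(** The delicate half of the order criterion is to recover, from vanishing derivatives, the
    denominators and coefficients that [ord_ge] demands. A form vanishing at p splits along lx and
    ly, and so does F; Cramer's rule between the two splittings eliminates, modulo F, the linear
    form that is not a local parameter. Iterated derivatives detect an order only if it is finite,
    and ly has infinite order along any component of Z that is a fibre of the second projection.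
    Smoothness excludes such fibres, because the transversal derivative of F is a form of positive
    degree d on the fibre and so has a zero there. Density is also proved fibrewise. Seen as a
    polynomial in the x-coordinate over the ring of the y-coordinate, F is nonzero in each fibre,
    and pseudo-division carries a vanishing statement from the fibres over general y to all of them.
    No decomposition of Z into components enters. *)

Section MPolyMap.

Lemma mpoly_alg_ind (n : nat) (R : nzRingType) (P : {mpoly R[n]} -> Prop) :
  (forall c, P c%:MP) -> (forall i, P 'X_i) ->
  (forall p q, P p -> P q -> P (p + q)) ->
  (forall p q, P p -> P q -> P (p * q)) -> forall p, P p.
Proof.
move=> PC PX PD PM p; rewrite [p]mpolyE.
elim/big_ind: _ => [|q r|m _]; [by rewrite -mpolyC0 | exact: PD |].
rewrite -mul_mpolyC; apply: (PM) => //; rewrite mpolyXE_id.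
elim/big_ind: _ => [|q r|i _]; [by rewrite -mpolyC1 | exact: PM |].
by elim: (m i) => [|k IHk]; rewrite ?expr0 -?mpolyC1 // exprS; apply: PM.
Qed.

Lemma mmapXU (n : nat) (R S : nzRingType) (f : {rmorphism R -> S})
    (w : 'I_n -> S) i : mmap f w 'X_i = w i.
Proof. by rewrite mmapX mmap1U. Qed.

Lemma rmorph_mmap (n : nat) (R : nzRingType) (S T : nzRingType)
    (f : {rmorphism R -> S}) (g : {rmorphism S -> T}) (w : 'I_n -> S) p :
  g (mmap f w p) = mmap (g \o f) (g \o w) p.
Proof.
rewrite /mmap rmorph_sum; apply: eq_bigr => m _.
rewrite rmorphM /mmap1 rmorph_prod; congr (_ * _).
by apply: eq_bigr => i _; rewrite rmorphXn.
Qed.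

Lemma eq_mmap (n : nat) (R S : nzRingType) (f g : R -> S) (v w : 'I_n -> S) p :
  f =1 g -> v =1 w -> mmap f v p = mmap g w p.
Proof.
move=> fg vw; rewrite /mmap; apply: eq_bigr => m _.
by rewrite fg (mmap1_eq _ vw).
Qed.

Lemma mderivXU (n : nat) (R : nzRingType) (i j : 'I_n) :
  ('X_i : {mpoly R[n]})^`M(j) = (i == j)%:R.
Proof.
rewrite mderivX mnm1E; case: eqP => [->|_]; last by rewrite scale0r.
rewrite scale1r (_ : (U_(j) - U_(j) = 0)%MM) ?mpolyX0 //.
by apply/mnmP=> k; rewrite mnmBE mnm0E subnn.
Qed.

(** Chain rule, checked on generators. It serves to differentiate restrictions to coordinate lines
    and to charts, and the exchange of the two factors. *)
Lemma mmap_deriv (n : nat) (R : comNzRingType) (T : comNzRingType)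
    (f : {rmorphism R -> T}) (D : T -> T) (w : 'I_n -> T) (p : {mpoly R[n]}) :
  {morph D : x y / x + y} -> (forall x y, D (x * y) = D x * y + x * D y) ->
  (forall c, D (f c) = 0) ->
  D (mmap f w p) = \sum_(k < n) D (w k) * mmap f w p^`M(k).
Proof.
move=> DD DM DC; elim/mpoly_alg_ind: p => [c|i|p q IHp IHq|p q IHp IHq].
- rewrite mmapC DC big1 // => k _; by rewrite mderivC mmap0 mulr0.
- rewrite mmapXU (bigD1 i) //= mderivXU eqxx rmorph1 mulr1 big1 ?addr0 // => k.
  by move=> /negPf ki; rewrite mderivXU eq_sym ki rmorph0 mulr0.
- rewrite rmorphD DD IHp IHq -big_split; apply: eq_bigr => k _.
  by rewrite mderivD rmorphD mulrDr.
rewrite rmorphM DM IHp IHq mulr_suml mulr_sumr -big_split.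
apply: eq_bigr => k _ /=; rewrite mderivM rmorphD !rmorphM /=; ring.
Qed.

End MPolyMap.

(** * Bihomogeneous polynomials *)

Section Bihomog.

Variable K : closedFieldType.

Local Notation S := {mpoly K[2 + 2]}.
Local Notation pt := ('rV[K]_2 * 'rV[K]_2)%type.

Definition xdeg (m : 'X_{1..(2 + 2)}) : nat := (\sum_(i < 2) m (xi i))%N.
Definition ydeg (m : 'X_{1..(2 + 2)}) : nat := (\sum_(i < 2) m (yi i))%N.

Fact xdeg0 : xdeg 0%MM = 0%N.
Proof. by rewrite /xdeg big1 // => i _; rewrite mnm0E. Qed.

Fact xdegD : {morph xdeg : m n / (m + n)%MM >-> (m + n)%N}.
Proof. by move=> m n; rewrite /xdeg -big_split; apply: eq_bigr => i _; rewrite mnmDE. Qed.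

HB.instance Definition _ := isMeasure.Build (2 + 2)%N xdeg xdeg0 xdegD.

Fact ydeg0 : ydeg 0%MM = 0%N.
Proof. by rewrite /ydeg big1 // => i _; rewrite mnm0E. Qed.

Fact ydegD : {morph ydeg : m n / (m + n)%MM >-> (m + n)%N}.
Proof. by move=> m n; rewrite /ydeg -big_split; apply: eq_bigr => i _; rewrite mnmDE. Qed.

HB.instance Definition _ := isMeasure.Build (2 + 2)%N ydeg ydeg0 ydegD.

Lemma bihomogE k l (s : S) :
  bihomog k l s <-> s \is k.-homog for xdeg /\ s \is l.-homog for ydeg.
Proof.
split=> [hs|[/dhomogP hx /dhomogP hy] m ms]; last by split; [exact: hx|exact: hy].
by split; apply/dhomogP => m ms; case: (hs m ms).
Qed.

Lemma bihomog0 a b : bihomog a b (0 : S).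
Proof. by move=> m; rewrite msupp0. Qed.

Lemma bihomogC (c : K) : bihomog 0 0 (c%:MP : S).
Proof.
apply/bihomogE; rewrite -[c%:MP]mulr1 mul_mpolyC.
by split; apply: rpredZ; exact: dhomog1.
Qed.

Lemma bihomogD a b (s t : S) : bihomog a b s -> bihomog a b t -> bihomog a b (s + t).
Proof. by rewrite !bihomogE => -[sx sy] [tx ty]; split; apply: rpredD. Qed.

Lemma bihomogN a b (s : S) : bihomog a b s -> bihomog a b (- s).
Proof. by rewrite !bihomogE => -[sx sy]; split; rewrite rpredN. Qed.

Lemma bihomogB a b (s t : S) : bihomog a b s -> bihomog a b t -> bihomog a b (s - t).
Proof. by move=> hs ht; apply: bihomogD => //; exact: bihomogN. Qed.

Lemma bihomogZ a b c (s : S) : bihomog a b s -> bihomog a b (c *: s).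
Proof. by rewrite !bihomogE => -[sx sy]; split; apply: rpredZ. Qed.

Lemma bihomog_sum a b (I : Type) (r : seq I) (P : pred I) (f : I -> S) :
  (forall i, P i -> bihomog a b (f i)) -> bihomog a b (\sum_(i <- r | P i) f i).
Proof. by move=> hf; elim/big_ind: _ => //; [exact: bihomog0|exact: bihomogD]. Qed.

Lemma bihomogM a b a' b' (s t : S) :
  bihomog a b s -> bihomog a' b' t -> bihomog (a + a') (b + b') (s * t).
Proof. by rewrite !bihomogE => -[sx sy] [tx ty]; split; apply: dhomogM. Qed.

Lemma bihomogXn a b (s : S) k : bihomog a b s -> bihomog (a * k) (b * k) (s ^+ k).
Proof. by rewrite !bihomogE => -[sx sy]; split; apply: dhomogMn. Qed.

Lemma xi_eq i j : (xi i == xi j) = (i == j).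
Proof. exact: (inj_eq (@lshift_inj _ _)). Qed.
Lemma yi_eq i j : (yi i == yi j) = (i == j).
Proof. exact: (inj_eq (@rshift_inj _ _)). Qed.
Lemma xi_yi i j : (xi i == yi j) = false.
Proof. by apply/negP => /eqP/(congr1 val) /=; have := ltn_ord i; lia. Qed.
Lemma yi_xi i j : (yi i == xi j) = false.
Proof. by rewrite eq_sym xi_yi. Qed.
Definition idxE := (xi_eq, yi_eq, xi_yi, yi_xi).

Lemma bihomogX (i : 'I_2) : bihomog 1 0 ('X_(xi i) : S).
Proof.
move=> m; rewrite msuppX inE => /eqP->; split.
  rewrite (bigD1 i) //= mnm1E eqxx big1 // => j /negPf ji.
  by rewrite mnm1E xi_eq eq_sym ji.
by rewrite big1 // => j _; rewrite mnm1E xi_yi.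
Qed.

Lemma bihomogY (i : 'I_2) : bihomog 0 1 ('X_(yi i) : S).
Proof.
move=> m; rewrite msuppX inE => /eqP->; split.
  by rewrite big1 // => j _; rewrite mnm1E yi_xi.
rewrite (bigD1 i) //= mnm1E eqxx big1 // => j /negPf ji.
by rewrite mnm1E yi_eq eq_sym ji.
Qed.

Lemma bihomog_derivx a b i (s : S) : bihomog a b s -> bihomog a.-1 b s^`M(xi i).
Proof.
move=> hs m; rewrite mcoeff_msupp mcoeff_deriv => nz.
have /hs : (m + U_(xi i))%MM \in msupp s.
  by rewrite mcoeff_msupp; apply: contra nz => /eqP->; rewrite mul0rn.
rewrite -/(xdeg _) -/(ydeg _) xdegD ydegD => -[<- <-].
have [] := @bihomogX i U_(xi i)%MM; first by rewrite msuppX inE.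
by rewrite -/(xdeg _) -/(ydeg _) => -> ->; rewrite addn0 addn1.
Qed.

Lemma bihomog_derivy a b i (s : S) : bihomog a b s -> bihomog a b.-1 s^`M(yi i).
Proof.
move=> hs m; rewrite mcoeff_msupp mcoeff_deriv => nz.
have /hs : (m + U_(yi i))%MM \in msupp s.
  by rewrite mcoeff_msupp; apply: contra nz => /eqP->; rewrite mul0rn.
rewrite -/(xdeg _) -/(ydeg _) xdegD ydegD => -[<- <-].
have [] := @bihomogY i U_(yi i)%MM; first by rewrite msuppX inE.
by rewrite -/(xdeg _) -/(ydeg _) => -> ->; rewrite addn0 addn1.
Qed.

Lemma mulX_mderivX n (k : 'I_n) (m : 'X_{1..n}) :
  'X_k * ('X_[m])^`M(k) = (m k)%:R *: 'X_[m] :> {mpoly K[n]}.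
Proof.
rewrite mderivX -scalerAr; case: (posnP (m k)) => [->|mk].
  by rewrite !scale0r.
rewrite -mpolyXD; congr (_ *: 'X_[_]); apply/mnmP => l.
by rewrite mnmDE mnmBE mnm1E; case: eqP => [<-|_] /=; rewrite ?subnKC ?subn0.
Qed.

Lemma euler_x a b (s : S) : bihomog a b s ->
  \sum_(i < 2) 'X_(xi i) * s^`M(xi i) = a%:R *: s.
Proof.
move=> hs; rewrite {2}[s]mpolyE scaler_sumr.
under eq_bigr do rewrite {1}[s]mpolyE linear_sum mulr_sumr.
rewrite exchange_big /= big_seq [RHS]big_seq; apply: eq_bigr => m ms.
rewrite -(hs m ms).1 natr_sum scaler_suml; apply: eq_bigr => i _.
by rewrite linearZ /= -scalerAr mulX_mderivX !scalerA mulrC.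
Qed.

Lemma euler_y a b (s : S) : bihomog a b s ->
  \sum_(i < 2) 'X_(yi i) * s^`M(yi i) = b%:R *: s.
Proof.
move=> hs; rewrite {2}[s]mpolyE scaler_sumr.
under eq_bigr do rewrite {1}[s]mpolyE linear_sum mulr_sumr.
rewrite exchange_big /= big_seq [RHS]big_seq; apply: eq_bigr => m ms.
rewrite -(hs m ms).2 natr_sum scaler_suml; apply: eq_bigr => i _.
by rewrite linearZ /= -scalerAr mulX_mderivX !scalerA mulrC.
Qed.

(** Projection to one bidegree. Ideal membership and [eq_on] come with arbitrary coefficients, and
    this projection makes them bihomogeneous. *)
Definition bipart a b (s : S) : S := pihomog xdeg a (pihomog ydeg b s).

Fact bipart_is_linear a b : linear (bipart a b).
Proof. by move=> c s t; rewrite /bipart !linearP. Qed.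

HB.instance Definition _ a b :=
  GRing.isLinear.Build K S S *:%R (bipart a b) (bipart_is_linear a b).

Lemma bipartX a b m :
  bipart a b 'X_[m] = if (xdeg m == a) && (ydeg m == b) then 'X_[m] else 0.
Proof.
rewrite /bipart pihomogX; case: (ydeg m == b); rewrite ?andbT ?andbF ?raddf0 //.
exact: pihomogX.
Qed.

Lemma bipart_bihomog a b s : bihomog a b (bipart a b s).
Proof.
rewrite [s]mpolyE linear_sum; apply: bihomog_sum => m _.
rewrite linearZ /= bipartX.
apply: bihomogZ; case: ifP => [/andP[/eqP mx /eqP my]|_]; last exact: bihomog0.
by move=> l; rewrite msuppX inE => /eqP->.
Qed.

Lemma bipart_id a b s : bihomog a b s -> bipart a b s = s.
Proof. by rewrite bihomogE /bipart => -[hx hy]; rewrite !pihomog_dE. Qed.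

Lemma bipart_neq a b a' b' s :
  bihomog a' b' s -> (a' != a) || (b' != b) -> bipart a b s = 0.
Proof.
rewrite bihomogE /bipart => -[hx hy] neq.
have [eqb|nb] := eqVneq b' b; last by rewrite (pihomog_ne0 nb hy) raddf0.
move: hy neq; rewrite eqb eqxx orbF => hy na.
by rewrite (pihomog_dE hy) (pihomog_ne0 na hx).
Qed.

(** The second branch does real work: a generator whose bidegree does not fit contributes nothing.
    This removes the F_y from J_(d-1,e) and the multiples of F from x-degree d-1. *)
Lemma bipartM a b a' b' (s t : S) : bihomog a' b' t ->
  bipart a b (s * t) =
  if (a' <= a)%N && (b' <= b)%N then bipart (a - a') (b - b') s * t else 0.
Proof.
move=> ht; rewrite [s]mpolyE mulr_suml !linear_sum mulr_suml.
case: ifP => le; last first.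
  apply: big1 => m _; apply: bipart_neq.
    by rewrite -scalerAl; apply/bihomogZ/bihomogM/ht => l; rewrite msuppX inE => /eqP->.
  by apply: contraFT le; rewrite negb_or !negbK => /andP[/eqP<- /eqP<-];
    rewrite !leq_addl.
apply: eq_bigr => m _; have hm : bihomog (xdeg m + a') (ydeg m + b') ((s@_m *:
  'X_[m]) * t).
  by rewrite -scalerAl; apply/bihomogZ/bihomogM/ht => l; rewrite msuppX inE => /eqP->.
rewrite linearZ /= bipartX; case: ifP => [/andP[/eqP mx /eqP my]|neq].
  apply: bipart_id; move: hm; rewrite mx my; case/andP: le => la lb.
  by rewrite !subnK.
rewrite scaler0 mul0r; apply: (bipart_neq hm).
apply: contraFT neq; rewrite negb_or !negbK => /andP[/eqP<- /eqP<-].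
by rewrite !addnK !eqxx.
Qed.

Lemma bihomog00 (s : S) : bihomog 0 0 s -> exists c : K, s = c%:MP.
Proof.
move=> hs; exists s@_0; rewrite {1}[s]mpolyE.
have supp m : m \in msupp s -> m = 0%MM.
  case/hs => /eqP; rewrite sum_nat_eq0 => /forall_inP mx /eqP.
  rewrite sum_nat_eq0 => /forall_inP my.
  apply/mnmP => k; rewrite mnm0E; apply/eqP.
  by case: (split_ordP k) => j ->; [exact: mx | exact: my].
have [s0|ns0] := eqVneq s 0; first by rewrite s0 msupp0 big_nil mcoeff0.
have: msupp s != [::] by rewrite msupp_eq0.
have := msupp_uniq s; have: forall m, m \in msupp s -> m = 0%MM by [].
case: (msupp s) => // m [|l r] mem //=.
  by rewrite big_seq1 (mem m) ?inE // mpolyX0 -mul_mpolyC mulr1.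
by rewrite (mem m) ?inE ?eqxx // (mem l) ?inE ?eqxx ?orbT.
Qed.

Lemma evpXx i (p : pt) : evp 'X_(xi i) p = p.1 ord0 i.
Proof. by rewrite /evp mevalXU row_mxEl. Qed.
Lemma evpXy i (p : pt) : evp 'X_(yi i) p = p.2 ord0 i.
Proof. by rewrite /evp mevalXU row_mxEr. Qed.
Lemma evp0 (p : pt) : evp 0 p = 0.
Proof. exact: meval0. Qed.
Lemma evpC c (p : pt) : evp c%:MP p = c.
Proof. exact: mevalC. Qed.
Lemma evpD s t (p : pt) : evp (s + t) p = evp s p + evp t p.
Proof. exact: mevalD. Qed.
Lemma evpN s (p : pt) : evp (- s) p = - evp s p.
Proof. exact: mevalN. Qed.
Lemma evpB s t (p : pt) : evp (s - t) p = evp s p - evp t p.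
Proof. exact: mevalB. Qed.
Lemma evpM s t (p : pt) : evp (s * t) p = evp s p * evp t p.
Proof. exact: mevalM. Qed.
Lemma evpZ c s (p : pt) : evp (c *: s) p = c * evp s p.
Proof. exact: mevalZ. Qed.
Lemma evp_sum (I : Type) (r : seq I) (P : pred I) (f : I -> S) (p : pt) :
  evp (\sum_(i <- r | P i) f i) p = \sum_(i <- r | P i) evp (f i) p.
Proof. by rewrite /evp raddf_sum. Qed.

End Bihomog.

(** * Order of vanishing along a derivation *)

Section Vanishing.

Variables (S : comNzRingType) (K : idomainType).
Variables (D : {additive S -> S}) (ev : {rmorphism S -> K}).
Hypothesis DM : forall s t, D (s * t) = D s * t + s * D t.

(** In characteristic 0 this says that the Taylor series with coefficients [ev (iter l D s)] divided
    by l! starts in degree k or later. Taking this series is multiplicative; the product lemmas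
    below express that without dividing by factorials. *)
Definition vanish k s := forall l, (l < k)%N -> ev (iter l D s) = 0.

Lemma iterD_additive l : {morph iter l D : s t / s + t}.
Proof. by move=> s t; elim: l => //= l ->; rewrite raddfD. Qed.

Lemma vanishS k s : vanish k.+1 s <-> ev s = 0 /\ vanish k (D s).
Proof.
split=> [h|[h0 h] [|l] lk //]; last by rewrite iterSr; exact: h.
by split=> [|l lk]; [exact: (h 0%N) | rewrite -iterSr; exact: h].
Qed.

Lemma vanishSr k s : vanish k.+1 s <-> vanish k s /\ ev (iter k D s) = 0.
Proof.
split=> [h|[h hk] l]; last by rewrite ltnS leq_eqVlt => /orP[/eqP->|/h].
by split=> [l lk|]; apply: h => //; exact: ltnW.
Qed.

Lemma vanish0 k : vanish k 0.
Proof.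
move=> l _; suff -> : iter l D 0 = 0 by rewrite rmorph0.
by elim: l => //= l ->; rewrite raddf0.
Qed.

Lemma vanishD k s t : vanish k s -> vanish k t -> vanish k (s + t).
Proof. by move=> hs ht l lk; rewrite iterD_additive rmorphD hs // ht // addr0. Qed.

Lemma vanishN k s : vanish k s -> vanish k (- s).
Proof.
move=> hs l lk; have := iterD_additive l s (- s); rewrite subrr => /(congr1 ev).
by rewrite rmorphD hs // add0r => <-; exact: (vanish0 lk).
Qed.

Lemma vanishB k s t : vanish k s -> vanish k t -> vanish k (s - t).
Proof. by move=> hs ht; apply: vanishD => //; exact: vanishN. Qed.

Lemma vanish_sum k (I : Type) (r : seq I) (P : pred I) (f : I -> S) :
  (forall i, P i -> vanish k (f i)) -> vanish k (\sum_(i <- r | P i) f i).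
Proof. by move=> h; elim/big_ind: _ => //; [exact: vanish0 | exact: vanishD]. Qed.

Lemma vanish_pred k s : vanish k s -> vanish k.-1 (D s).
Proof. by case: k => [|k] // /vanishS[]. Qed.

Lemma vanishM k m s t : vanish k s -> vanish m t -> vanish (k + m) (s * t).
Proof.
(* The claim is weakened to every n with n <= k + m. With equality the induction would break at k =
   0, where [k.-1] does not lower the sum. *)
move: {-2}(k + m)%N (leqnn (k + m)) => n.
elim: n k m s t => [|n IHn] k m s t nE hs ht //.
apply/vanishS; split.
  rewrite rmorphM; case: k nE hs => [|k] nE hs; last by rewrite (hs 0%N) ?mul0r.
  by case: m nE ht => // m nE ht; rewrite (ht 0%N) ?mulr0.
rewrite DM; apply: vanishD.
  by apply: (IHn k.-1 m) => //; [lia | exact: vanish_pred].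
by apply: (IHn k m.-1) => //; [lia | exact: vanish_pred].
Qed.

Lemma vanishX k m s : vanish k s -> vanish (k * m) (s ^+ m).
Proof.
by move=> hs; elim: m => [|m IHm]; rewrite ?muln0 // mulnS exprS; apply: vanishM.
Qed.

Lemma vanishMl k s t : vanish k t -> vanish k (s * t).
Proof. by move=> ht; rewrite -[k]add0n; apply: vanishM. Qed.

(** In the Leibniz expansion every other term differentiates s fewer than k times or t fewer than m
    times, hence dies under [ev]. The induction is Pascal's rule. *)
Lemma ev_iterDM k m s t : vanish k s -> vanish m t ->
  ev (iter (k + m) D (s * t)) =
  'C(k + m, k)%:R * (ev (iter k D s) * ev (iter m D t)).
Proof.
move: {2}(k + m)%N (erefl (k + m)%N) => n.
elim: n k m s t => [|n IHn] [|k] [|m] s t //=; rewrite ?addSn ?add0n ?addn0.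
- by move=> _ _ _; rewrite mul1r rmorphM.
- case=> mn hs ht; rewrite -iterS iterSr DM iterD_additive rmorphD.
  rewrite (vanishM (k := 0) _ ht) // add0r -[X in iter X _ (s * _)]add0n IHn //.
    by rewrite add0n -iterSr !bin0.
  by case/vanishS: ht.
- case=> kn hs ht; rewrite -iterS iterSr DM iterD_additive rmorphD.
  rewrite [X in _ + X](_ : _ = 0); last first.
    by apply: (vanishM (m := 0) hs); rewrite ?addn0.
  rewrite addr0 -[X in iter X _ (_ * t)]addn0 IHn ?addn0 //.
    by rewrite -iterSr !binn.
  by case/vanishS: hs.
case=> kmn hs ht; rewrite -iterS iterSr DM iterD_additive rmorphD.
rewrite (_ : ev (iter (k + m.+1) D (D s * t)) =
  'C(k + m.+1, k)%:R * (ev (iter k D (D s)) * ev (iter m.+1 D t))); last first.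
  by apply: IHn => //; case/vanishS: hs.
rewrite (_ : ev (iter (k + m.+1) D (s * D t)) =
  'C(k + m.+1, k.+1)%:R * (ev (iter k.+1 D s) * ev (iter m D (D t)))); last first.
  by rewrite addnS -addSn; apply: IHn => //; [lia | case/vanishS: ht].
by rewrite -!iterSr binS natrD mulrDl addrC.
Qed.

Lemma ev_iterDX k s : ev s = 0 ->
  ev (iter k D (s ^+ k)) = (k`!)%:R * ev (D s) ^+ k.
Proof.
move=> s0; have hs : vanish 1 s by move=> [|l].
elim: k => [|k IHk]; first by rewrite fact0 mul1r !expr0 rmorph1.
rewrite exprS -add1n ev_iterDM //; last by rewrite -[k in vanish k]mul1n; exact: vanishX.
by rewrite IHk /= bin1 add1n factS natrM exprS; ring.
Qed.

Lemma vanish_unitM k h s : ev h != 0 -> vanish k (h * s) -> vanish k s.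
Proof.
move=> h0; elim: k => // k IHk /vanishSr[hk hsk]; apply/vanishSr.
split; first exact: IHk.
move: hsk; rewrite -[k]add0n (ev_iterDM (k := 0)) ?add0n //; last exact: IHk.
by rewrite bin0 mul1r => /eqP; rewrite mulf_eq0 (negPf h0) => /eqP.
Qed.

End Vanishing.

Section OrdTwo.

Lemma ord2P (i : 'I_2) :
  (i = ord0 /\ rev_ord i = ord_max) \/ (i = ord_max /\ rev_ord i = ord0).
Proof.
case: (unliftP ord0 i) => [j ->|->]; [right|left]; split=> //; apply/val_inj => //=.
all: by rewrite (ord1 j).
Qed.

Lemma rev_ord_neq (i : 'I_2) : (rev_ord i == i) = false.
Proof. by case: (ord2P i) => -[-> ->]. Qed.

Lemma sum_ord2 (V : nmodType) (i : 'I_2) (f : 'I_2 -> V) :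
  \sum_(k < 2) f k = f i + f (rev_ord i).
Proof.
rewrite !big_ord_recl big_ord0 addr0 (_ : lift ord0 ord0 = ord_max); last exact/val_inj.
by case: (ord2P i) => -[-> ->] //; rewrite addrC.
Qed.

Lemma forall_ord2 (P : 'I_2 -> Prop) (i : 'I_2) :
  P i -> P (rev_ord i) -> forall k, P k.
Proof.
move=> Pi Pr k; move: Pi Pr.
by case: (ord2P i) => -[-> ->]; case: (ord2P k) => -[-> _].
Qed.

End OrdTwo.

(** * Charts of the surface and the derivation along Z *)

Section Delta.

Variable K : closedFieldType.

Local Notation S := {mpoly K[2 + 2]}.
Local Notation pt := ('rV[K]_2 * 'rV[K]_2)%type.

Implicit Types (F s t : S) (p q : pt) (i j : 'I_2).

Lemma mmap_scale (T : comNzRingType) (f : {rmorphism K -> T}) (c c' : T)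
    (v w : 'I_(2 + 2) -> T) a b s :
  (forall i, w (xi i) = c * v (xi i)) -> (forall j, w (yi j) = c' * v (yi j)) ->
  bihomog a b s -> mmap f w s = c ^+ a * c' ^+ b * mmap f v s.
Proof.
move=> wx wy hs; rewrite /mmap mulr_sumr big_seq [RHS]big_seq.
apply: eq_bigr => m ms; rewrite mulrCA; congr (_ * _).
rewrite /mmap1 !big_split_ord /=.
rewrite -[a](hs m ms).1 -[b](hs m ms).2 !expr_sum mulrACA -!big_split /=.
by apply: eq_bigr => i _; rewrite wx wy !exprMn.
Qed.

Lemma evp_scale a b s c c' p : bihomog a b s ->
  evp s (c *: p.1, c' *: p.2) = c ^+ a * c' ^+ b * evp s p.
Proof.
apply: (@mmap_scale _ idfun) => i.
  by rewrite !row_mxEl mxE.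
by rewrite !row_mxEr mxE.
Qed.

Lemma evp_pt_eq a b s p q : bihomog a b s -> pt_eq p q ->
  exists2 c, c != 0 & evp s q = c * evp s p.
Proof.
move=> hs [[c [c0 e1]] [c' [c'0 e2]]]; exists (c ^+ a * c' ^+ b).
  by rewrite mulf_neq0 ?expf_neq0.
by rewrite -(evp_scale c c' p hs) -e1 -e2 -surjective_pairing.
Qed.

Lemma evp_pt_eq_neq0 a b s p q : bihomog a b s -> pt_eq p q ->
  (evp s q == 0) = (evp s p == 0).
Proof.
by move=> hs /(evp_pt_eq hs)[c c0 ->]; rewrite mulf_eq0 (negPf c0).
Qed.

(* The sign relating [line z v] to v_i z_(1-i) - v_(1-i) z_i. *)
Definition chart_sign i : K := if i == ord0 then -1 else 1.

Lemma chart_sign_neq0 i : chart_sign i != 0.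
Proof. by rewrite /chart_sign; case: ifP => _; rewrite ?oppr_eq0 oner_eq0. Qed.

Lemma lineE (z : 'I_2 -> 'I_(2 + 2)) (v : 'rV[K]_2) i :
  line z v = chart_sign i *: (v ord0 i *: 'X_(z (rev_ord i)) - v ord0 (rev_ord i) *:
    'X_(z i)).
Proof.
rewrite /line /chart_sign; case: (ord2P i) => -[-> ->] /=.
  by rewrite scaleN1r opprB.
by rewrite scale1r.
Qed.

Lemma bihomog_linex v : bihomog 1 0 (line xi v : S).
Proof. by apply: bihomogB; apply: bihomogZ; exact: bihomogX. Qed.

Lemma bihomog_liney v : bihomog 0 1 (line yi v : S).
Proof. by apply: bihomogB; apply: bihomogZ; exact: bihomogY. Qed.

Lemma evp_linex p : evp (line xi p.1) p = 0.
Proof. by rewrite /line evpB !evpZ !evpXx mulrC subrr. Qed.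

Lemma evp_liney p : evp (line yi p.2) p = 0.
Proof. by rewrite /line evpB !evpZ !evpXy mulrC subrr. Qed.

Lemma line_deriv (z : 'I_2 -> 'I_(2 + 2)) (v : 'rV[K]_2) i k :
  (line z v)^`M(k) =
  (chart_sign i * (v ord0 i * (z (rev_ord i) == k)%:R - v ord0 (rev_ord i) * (z i == k)%:R))%:MP.
Proof.
rewrite (lineE _ _ i) mderivZ mderivB !mderivZ !mderivXU.
by rewrite mpolyCM -mul_mpolyC mpolyCB !mpolyCM -!mul_mpolyC !rmorph_nat.
Qed.

(** The substitution [sigma] replaces x by the multiple of p.1 with the same coordinate x_i, and y
    likewise. It changes each variable by a multiple of lx or ly, so [s - sigma s] lies in the ideal
    (lx, ly), while [sigma s] is s(p) times a form and vanishes. Projecting to a bidegree makes A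
    and B bihomogeneous. *)
Lemma hadamard_decomposition p i j a b s :
  p.1 ord0 i != 0 -> p.2 ord0 j != 0 -> bihomog a b s -> evp s p = 0 ->
  exists A B, [/\ s = A * line xi p.1 + B * line yi p.2,
    bihomog a.-1 b A, bihomog a b.-1 B, (a = 0%N -> A = 0) & (b = 0%N -> B = 0)].
Proof.
move=> pi pj hs s0.
pose v (k : 'I_(2 + 2)) := row_mx p.1 p.2 ord0 k.
pose c : S := (p.1 ord0 i)^-1 *: 'X_(xi i).
pose c' : S := (p.2 ord0 j)^-1 *: 'X_(yi j).
pose w (k : 'I_(2 + 2)) := (if (k < 2)%N then c else c') * (v k)%:MP.
pose sigma := mmap (@mpolyC (2 + 2) K) w.
have xi_lt k : (xi k < 2)%N by exact: (ltn_ord k).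
have yi_lt k : (yi k < 2)%N = false by rewrite ltnNge leq_addr.
have wx k : w (xi k) = (p.1 ord0 k / p.1 ord0 i) *: 'X_(xi i).
  by rewrite /w /v xi_lt row_mxEl mulrC mul_mpolyC /c scalerA.
have wy k : w (yi k) = (p.2 ord0 k / p.2 ord0 j) *: 'X_(yi j).
  by rewrite /w /v yi_lt row_mxEr mulrC mul_mpolyC /c' scalerA.
have gen t : exists A B, t - sigma t = A * line xi p.1 + B * line yi p.2.
  elim/mpoly_alg_ind: t => [x|k|t1 t2|t1 t2].
  - by exists 0, 0; rewrite /sigma mmapC subrr !mul0r addr0.
  - rewrite /sigma mmapXU; case: (split_ordP k) => l ->.
      rewrite -[lshift 2 l]/(xi l).
      move: l; apply: (@forall_ord2 _ i).
        by exists 0, 0; rewrite wx divff // scale1r subrr !mul0r addr0.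
      exists ((chart_sign i * p.1 ord0 i)^-1)%:MP, 0;
        rewrite mul0r addr0 wx (lineE _ _ i).
      have := chart_sign_neq0 i => s_i.
      rewrite mul_mpolyC !scalerA scalerBr !scalerA; congr (_ - _ *: _).
        by rewrite -[LHS]scale1r; congr (_ *: _); field; apply/andP.
      by field; apply/andP.
    rewrite -[rshift 2 l]/(yi l).
    move: l; apply: (@forall_ord2 _ j).
      by exists 0, 0; rewrite wy divff // scale1r subrr !mul0r addr0.
    exists 0, ((chart_sign j * p.2 ord0 j)^-1)%:MP; rewrite mul0r add0r wy (lineE _ _ j).
    have := chart_sign_neq0 j => s_j.
    rewrite mul_mpolyC !scalerA scalerBr !scalerA; congr (_ - _ *: _).
      by rewrite -[LHS]scale1r; congr (_ *: _); field; apply/andP.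
    by field; apply/andP.
  - case=> A1 [B1 e1] [A2 [B2 e2]]; exists (A1 + A2), (B1 + B2).
    by rewrite /sigma rmorphD /= -/sigma opprD addrACA e1 e2; ring.
  case=> A1 [B1 e1] [A2 [B2 e2]].
  exists (A1 * t2 + sigma t1 * A2), (B1 * t2 + sigma t1 * B2).
  rewrite /sigma rmorphM /= -/sigma.
  have -> : t1 * t2 - sigma t1 * sigma t2 =
    (t1 - sigma t1) * t2 + sigma t1 * (t2 - sigma t2) by ring.
  by rewrite e1 e2; ring.
have sigma0 : sigma s = 0.
  have -> : sigma s = c ^+ a * c' ^+ b * mmap (@mpolyC (2 + 2) K) (fun k => (v k)%:MP) s.
    by apply: mmap_scale => // k; rewrite /w ?xi_lt ?yi_lt.
  have -> : mmap (@mpolyC (2 + 2) K) (fun k => (v k)%:MP) s = (evp s p)%:MP.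
    by rewrite /evp /meval rmorph_mmap.
  by rewrite s0 mulr0.
have [A [B]] := gen s; rewrite sigma0 subr0 => sE.
(* For a = 0 the truncated [a.-1] is 0 instead of -1, so A has to be set to 0 by hand; likewise B
   for b = 0. *)
exists (if a is 0%N then 0 else bipart a.-1 b A),
  (if b is 0%N then 0 else bipart a b.-1 B).
split; last 4 first.
- by case: a {sE hs}; [exact: bihomog0 | move=> n; exact: bipart_bihomog].
- by case: b {sE hs}; [exact: bihomog0 | move=> n; exact: bipart_bihomog].
- by move=> ->.
- by move=> ->.
rewrite -{1}(bipart_id hs) {1}sE linearD /= (bipartM _ _ _ (@bihomog_linex p.1)).
rewrite (bipartM _ _ _ (@bihomog_liney p.2)).
by case: a {hs} => [|a]; case: b => [|b] //=; rewrite ?subn0 ?subn1 ?mul0r.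
Qed.

Section Chart.

Variables (F : S) (i j : 'I_2).

Definition delta s : S :=
  F^`M(yi (rev_ord j)) * s^`M(xi (rev_ord i)) - F^`M(xi (rev_ord i)) * s^`M(yi (rev_ord j)).

Fact delta_is_additive : {morph delta : s t / s - t}.
Proof. by move=> s t; rewrite /delta !mderivB; ring. Qed.

HB.instance Definition _ := GRing.isAdditive.Build S S delta delta_is_additive.

Lemma deltaM s t : delta (s * t) = delta s * t + s * delta t.
Proof. by rewrite /delta !mderivM; ring. Qed.

Lemma delta_self : delta F = 0.
Proof. by rewrite /delta mulrC subrr. Qed.

Lemma delta_linex v : delta (line xi v) = (chart_sign i * v ord0 i) *:
  F^`M(yi (rev_ord j)).
Proof.
rewrite /delta !(line_deriv _ _ i) !idxE eqxx [i == _]eq_sym rev_ord_neq /=.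
by rewrite !mulr0 !subr0 mulr1 mulr0 mpolyC0 mulr0 subr0 mulrC mul_mpolyC.
Qed.

Lemma delta_liney v : delta (line yi v) = - ((chart_sign j * v ord0 j) *:
  F^`M(xi (rev_ord i))).
Proof.
rewrite /delta !(line_deriv _ _ j) !idxE eqxx [j == _]eq_sym rev_ord_neq /=.
by rewrite !mulr0 !subr0 mulr1 mulr0 mpolyC0 mulr0 sub0r mulrC mul_mpolyC.
Qed.

Definition vanish_at p k s := vanish delta (meval (row_mx p.1 p.2 ord0)) k s.

Lemma vanish_at_self p k : evp F p = 0 -> vanish_at p k F.
Proof.
move=> Fp; case: k => [|k] //; apply/vanishS; split=> //=.
by rewrite delta_self; exact: vanish0.
Qed.

End Chart.

End Delta.

(** * The local rings of Z *)

Section LocalRing.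

Variable K : closedFieldType.
Hypothesis char0 : forall n, n.+1%:R != 0 :> K.

Local Notation S := {mpoly K[2 + 2]}.
Local Notation pt := ('rV[K]_2 * 'rV[K]_2)%type.

Variables (F : S) (d e : nat).
Hypotheses (d_gt0 : (0 < d)%N) (e_gt0 : (0 < e)%N).
Hypotheses (hF : bihomog d e F) (hZ : smooth F).

Implicit Types (s t h u : S) (p q : pt) (i j : 'I_2).

Lemma proj_eq_refl n (v : 'rV[K]_n) : proj_eq v v.
Proof. by exists 1; rewrite oner_eq0 scale1r. Qed.

Lemma proj_eq_sym n (u v : 'rV[K]_n) : proj_eq u v -> proj_eq v u.
Proof.
by case=> c [c0 ->]; exists c^-1; rewrite invr_eq0 scalerA mulVf // scale1r.
Qed.

Lemma pt_eq_sym p q : pt_eq p q -> pt_eq q p.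
Proof. by case=> ? ?; split; exact: proj_eq_sym. Qed.

Definition normalize i j p : pt := ((p.1 ord0 i)^-1 *: p.1, (p.2 ord0 j)^-1 *: p.2).

Lemma normalizeP i j p : p.1 ord0 i != 0 -> p.2 ord0 j != 0 ->
  [/\ pt_eq p (normalize i j p), (normalize i j p).1 ord0 i =
    1 & (normalize i j p).2 ord0 j = 1].
Proof.
move=> pi pj; split; rewrite ?mxE ?mulVf //.
by split; [exists (p.1 ord0 i)^-1 | exists (p.2 ord0 j)^-1]; rewrite invr_eq0.
Qed.

Lemma neq0_coord (v : 'rV[K]_2) : v != 0 -> exists i, v ord0 i != 0.
Proof.
move=> v0; apply/existsP; apply: contraR v0 => /existsPn h.
by apply/eqP/rowP => k; rewrite mxE; apply/eqP; move/negPn: (h k).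
Qed.

Lemma onX_chart p : onX p -> exists i j, p.1 ord0 i != 0 /\ p.2 ord0 j != 0.
Proof. by move=> [/neq0_coord[i pi] /neq0_coord[j pj]]; exists i, j. Qed.

Lemma smooth_at i j p : p.1 ord0 i != 0 -> p.2 ord0 j != 0 -> evp F p = 0 ->
  evp F^`M(xi (rev_ord i)) p != 0 \/ evp F^`M(yi (rev_ord j)) p != 0.
Proof.
move=> pi pj Fp; have [pq qi qj] := normalizeP pi pj.
have := hZ qi qj; rewrite (evp_pt_eq_neq0 (bihomog_derivx hF) pq).
rewrite (evp_pt_eq_neq0 (bihomog_derivy hF) pq); apply.
by apply/eqP; rewrite (evp_pt_eq_neq0 hF pq) Fp.
Qed.

Lemma eq_on_refl s : eq_on F s s.
Proof. by exists 0; rewrite mul0r subrr. Qed.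

Section AtPoint.

Variables (i j : 'I_2) (p : pt).
Hypotheses (pi : p.1 ord0 i != 0) (pj : p.2 ord0 j != 0) (Fp : evp F p = 0).

Local Notation vanish_at := (vanish_at F i j p).

Lemma vanish_at_eq_on k s t : eq_on F s t -> vanish_at k s <-> vanish_at k t.
Proof.
case=> q st; have vqF : vanish_at k (q * F) by apply: vanishMl; [exact: deltaM | exact:
  vanish_at_self].
split=> [vs|vt].
  by rewrite -[t](subKr s) st; exact: vanishB.
by rewrite -[s](subrK t) st; exact: vanishD.
Qed.

(** Here l1 is the local parameter. On Z one has A2 * l2 = - A1 * l1, so A2 * (A * l1 + B * l2) = (A
    * A2 - B * A1) * l1: each order of vanishing is traded for one factor l1, at the cost of the
    unit A2 in the denominator. The roles of l1 and l2 are kept abstract because either lx or ly may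
    be the parameter. *)
Lemma vanish_at_param (l1 l2 : S) (A1 A2 : S) :
  F = A1 * l1 + A2 * l2 -> (exists a b, bihomog a b A2) -> evp A2 p != 0 ->
  evp l1 p = 0 -> evp (delta F i j l1) p != 0 ->
  (forall a b u, bihomog a b u -> evp u p = 0 -> exists A B,
     u = A * l1 + B * l2 /\ exists a b, bihomog a b (A * A2 - B * A1)) ->
  forall k a b s, bihomog a b s -> vanish_at k s -> exists h u,
    [/\ exists a b, bihomog a b h, evp h p != 0,
        exists a b, bihomog a b u & eq_on F (h * s) (u * l1 ^+ k)].
Proof.
move=> FE hA2 A2p l1p Dl1p dec k a b s hs.
elim: k => [|k IHk] vs.
  exists 1, s; split; [by exists 0%N, 0%N; exact: bihomogC |
    by rewrite (evpC 1) oner_eq0 | by exists a, b|].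
  by rewrite expr0 mul1r mulr1; exact: eq_on_refl.
have [vks _] := (vanishSr _ _ _ _).1 vs.
have [h [u [hh hp [a' [b' hu]] hsu]]] := IHk vks.
have vl1 : vanish_at 1 l1 by move=> [|].
have up : evp u p = 0.
  have vul : vanish_at k.+1 (u * l1 ^+ k).
    by apply/(vanish_at_eq_on _ hsu); apply: vanishMl => //; exact: deltaM.
  (* At p the k-th iterate of delta on u * l1^k has the value u(p) * k! * (delta l1)(p)^k, so its
     vanishing forces u(p) = 0 in characteristic 0. *)
  have := vul k (ltnSn k).
  rewrite -{1}[k]add0n (ev_iterDM (@deltaM _ F i j) (k := 0)) //; last first.
    by rewrite -[X in vanish _ _ X]mul1n; apply: vanishX => //; exact: deltaM.
  rewrite bin0 mul1r (ev_iterDX (@deltaM _ F i j)) //= => /eqP.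
  rewrite !mulf_eq0 expf_eq0 (negPf Dl1p) andbF orbF.
  have := fact_gt0 k; case: (k`!)%N => // n _; rewrite (negPf (char0 n)) orbF.
  by move/eqP.
have [A [B [uE hAB]]] := dec _ _ _ hu up.
case: hsu => q hsu; case: hh => a1 [b1 hh]; case: hA2 => a2 [b2 hA2].
exists (A2 * h), (A * A2 - B * A1); split=> //.
- by exists (a2 + a1)%N, (b2 + b1)%N; exact: bihomogM.
- by rewrite evpM mulf_neq0.
exists (A2 * q + B * l1 ^+ k).
have -> : A2 * h * s = A2 * (h * s - u * l1 ^+ k) + A2 * u * l1 ^+ k by ring.
have BF : B * l1 ^+ k * F = B * l1 ^+ k * (A1 * l1 + A2 * l2) by rewrite -FE.
by rewrite hsu uE exprS [RHS]mulrDl BF; ring.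
Qed.

(** Both lx and ly vanish at p, so each generator of the k-th power vanishes to order l + (k - l);
    the denominator is a unit and cancels. *)
Lemma ord_ge_vanish_at k s : ord_ge F p s k -> vanish_at k s.
Proof.
case=> h [c [_ hp hs]]; apply: (vanish_unitM (@deltaM _ F i j) hp).
apply/(vanish_at_eq_on _ hs); apply: vanish_sum => l _.
apply: vanishMl; first exact: deltaM.
have lk : (l <= k)%N by rewrite -ltnS.
rewrite -[X in vanish _ _ X](subnKC lk); apply: vanishM; first exact: deltaM.
  rewrite -[X in vanish _ _ X]mul1n; apply: vanishX; first exact: deltaM.
  by case=> // _; exact: evp_linex.
rewrite -[X in vanish _ _ X]mul1n; apply: vanishX; first exact: deltaM.
by case=> // _; exact: evp_liney.
Qed.

(** Write F = A1 * lx + A2 * ly. At p the derivative F_x' is A1 times a nonzero constant and delta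
    ly is F_x' times one, so F_x'(p) <> 0 makes ly a parameter and A1 a unit. If F_y'(p) <> 0
    instead, lx and A2 take these roles. *)
Lemma vanish_at_ord_ge k a b s : bihomog a b s -> vanish_at k s -> ord_ge F p s k.
Proof.
move=> hs vs; set lx := line xi p.1; set ly := line yi p.2.
have lxp : evp lx p = 0 := evp_linex p.
have lyp : evp ly p = 0 := evp_liney p.
have [A1 [A2 [FE hA1 hA2 _ _]]] := hadamard_decomposition pi pj hF Fp.
have bAB a1 b1 A B u : bihomog a1 b1 u -> u = A * lx + B * ly ->
    bihomog a1.-1 b1 A -> bihomog a1 b1.-1 B -> (a1 = 0%N -> A = 0) -> (b1 = 0%N -> B =
      0) ->
    bihomog (a1 + d).-1 (b1 + e).-1 (A * A2 - B * A1).
  move=> hu uE hA hB A0 B0; apply: bihomogB.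
    case: a1 {hu hB} hA A0 => [_ ->|a1 hA _] //; first by rewrite mul0r; exact: bihomog0.
    have -> : (b1 + e).-1 = (b1 + e.-1)%N by lia.
    exact: bihomogM.
  case: b1 {hu hA} hB B0 => [_ ->|b1 hB _] //; first by rewrite mul0r; exact: bihomog0.
  have -> : (a1 + d).-1 = (a1 + d.-1)%N by lia.
  exact: bihomogM.
have [Fx|Fy] := smooth_at pi pj Fp.
- have A1p : evp A1 p != 0.
    apply: contraNneq Fx => A1p.
    rewrite FE mderivD !mderivM !evpD !evpM lxp lyp A1p !(line_deriv _ _ j) !idxE.
    by rewrite ?mulr0n !(evpC, mulr0, mul0r, addr0, subr0).
  have [] := @vanish_at_param ly lx A2 A1 _ _ A1p lyp _ _ k a b s hs vs.
  + by rewrite addrC.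
  + by exists d.-1, e.
  + by rewrite delta_liney evpN oppr_eq0 evpZ !mulf_neq0 ?chart_sign_neq0.
  + move=> a1 b1 u hu up;
    have [A [B [uE hA hB A0 B0]]] := hadamard_decomposition pi pj hu up.
    exists B, A; split; first by rewrite addrC.
    exists (a1 + d).-1, (b1 + e).-1; rewrite -opprB; apply: bihomogN.
    exact: bAB uE hA hB A0 B0.
  move=> h [u [hh hp _ hE]].
  (* Index 0 of the generators is the pure power ly^k; in the other case lx^k is the last one. *)
  exists h, (fun l => if l == ord0 then u else 0); split=> //.
  rewrite (bigD1 ord0) //= big1 ?addr0 => [|l /negPf->]; last by rewrite mul0r.
  by rewrite subn0 expr0 mul1r.
have A2p : evp A2 p != 0.
  apply: contraNneq Fy => A2p.
  rewrite FE mderivD !mderivM !evpD !evpM lxp lyp A2p !(line_deriv _ _ i) !idxE.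
  by rewrite ?mulr0n !(evpC, mulr0, mul0r, addr0, subr0).
have [] := @vanish_at_param lx ly A1 A2 FE _ A2p lxp _ _ k a b s hs vs.
- by exists d, e.-1.
- by rewrite delta_linex evpZ !mulf_neq0 ?chart_sign_neq0.
- move=> a1 b1 u hu up;
  have [A [B [uE hA hB A0 B0]]] := hadamard_decomposition pi pj hu up.
  exists A, B; split=> //.
  exists (a1 + d).-1, (b1 + e).-1; exact: bAB uE hA hB A0 B0.
move=> h [u [hh hp _ hE]].
exists h, (fun l => if l == ord_max then u else 0); split=> //.
rewrite (bigD1 ord_max) //= eqxx big1 ?addr0 => [|l /negPf->]; last by rewrite mul0r.
by rewrite subnn expr0 mulr1.
Qed.

Lemma ord_isP k a b s : bihomog a b s ->
  ord_is F p s k <-> vanish_at k s /\ evp (iter k (delta F i j) s) p != 0.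
Proof.
move=> hs; split=> [[/ord_ge_vanish_at vs nvs]|[vs nz]].
  split=> //; apply/eqP => z; apply: nvs; apply: (vanish_at_ord_ge hs).
  by apply/vanishSr.
split; first exact: vanish_at_ord_ge hs vs.
by move/ord_ge_vanish_at/vanishSr => [_]; apply/eqP.
Qed.

End AtPoint.

End LocalRing.

(** * Zeros of polynomials over an algebraically closed field *)

Section ClosedPoly.

Variable K : closedFieldType.

(** If f vanishes everywhere then f + 1 has no root, hence is constant because the field is
    closed. *)
Lemma poly_horner_eq0 (f : {poly K}) : (forall t, f.[t] = 0) -> f = 0.
Proof.
move=> f0; have : size (f + 1) = 1%N.
  apply/eqP; apply/negPn/negP => /closed_rootP[t].
  by rewrite rootE hornerD f0 hornerC add0r oner_eq0.
move/eqP/size_poly1P => [c _] fE.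
have fc : f = (c - 1)%:P by rewrite polyCB -fE polyC1 addrK.
by have := f0 0; rewrite fc hornerC => ->.
Qed.

Lemma poly_eq0_generic (f q : {poly K}) :
  q != 0 -> (forall t, q.[t] != 0 -> f.[t] = 0) -> f = 0.
Proof.
move=> q0 h; apply/eqP; have : f * q == 0.
  apply/eqP/poly_horner_eq0 => t; rewrite hornerM.
  by have [->|/h->] := eqVneq q.[t] 0; rewrite ?mulr0 ?mul0r.
by rewrite mulf_eq0 (negPf q0) orbF.
Qed.

Lemma poly_nonroot (q : {poly K}) : q != 0 -> exists t, q.[t] != 0.
Proof.
move=> q0; apply: NNPP => h; move/eqP: q0; apply; apply: poly_horner_eq0 => t.
by apply/eqP/negPn/negP => qt; apply: h; exists t.
Qed.

Lemma derivn_horner_eq0 (f : {poly K}) t : (forall n, n.+1%:R != 0 :> K) ->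
  (forall n, f^`(n).[t] = 0) -> f = 0.
Proof.
move=> char0 h; apply/eqP/negPn/negP => f0; have := h (size f).-1.
have sf : (0 < size f)%N by rewrite size_poly_gt0.
have -> : f^`((size f).-1) = (lead_coef f *+ (size f).-1`!)%:P.
  apply/polyP => k; rewrite coef_derivn coefC.
  case: k => [|k] /=; first by rewrite addn0 ffactnn.
  by rewrite nth_default ?mul0rn //; lia.
rewrite hornerC -mulr_natr => /eqP; rewrite mulf_eq0 lead_coef_eq0 (negPf f0) /=.
by have := fact_gt0 (size f).-1; case: (_`!)%N => // n _; rewrite (negPf (char0 n)).
Qed.

End ClosedPoly.

Section Unip.

Variable K : closedFieldType.

Local Notation S := {mpoly K[2 + 2]}.
Local Notation pt := ('rV[K]_2 * 'rV[K]_2)%type.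

(** Restriction to the affine line through p in the direction of the k-th coordinate. Its
    derivatives at 0 are the iterated partial derivatives at p, which links vanishing to infinite
    order with vanishing on a whole fibre. *)
Definition univariate (s : S) (p : pt) (k : 'I_(2 + 2)) : {poly K} :=
  mmap (@polyC K) (fun m => (row_mx p.1 p.2 ord0 m)%:P + (m == k)%:R *: 'X) s.

Lemma deriv_univariate s p k : (univariate s p k)^`() = univariate s^`M(k) p k.
Proof.
rewrite /univariate (mmap_deriv _ _ (D := @deriv K)); first last.
- exact: derivC.
- exact: derivM.
- exact: derivD.
rewrite (bigD1 k) //= derivD derivC derivZ derivX eqxx add0r scale1r mul1r.
by rewrite big1 ?addr0 // => m /negPf mk;
  rewrite derivD derivC derivZ mk scale0r add0r mul0r.
Qed.

Lemma horner_univariate s (p : pt) i t :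
  (univariate s p (xi i)).[t] = evp s (p.1 + t *: delta_mx ord0 i, p.2).
Proof.
rewrite -horner_evalE /univariate rmorph_mmap /evp /meval; apply: eq_mmap => [c|k] /=.
  by rewrite horner_evalE hornerC.
rewrite horner_evalE hornerD hornerZ hornerC hornerX.
case: (split_ordP k) => l -> /=.
  rewrite !row_mxEl !mxE eqxx /= -/(xi l) xi_eq; congr (_ + _).
  by rewrite mulrC.
by rewrite !row_mxEr -/(yi l) yi_xi mul0r addr0.
Qed.

(** Search the chart e0 + t e1 first. If there is no root, the form is a nonzero constant c there,
    so by homogeneity it is c t^a on e1 + t e0; since a > 0 the point e1 at infinity is a zero. *)
Lemma form_zero a b (s : S) (w : 'rV[K]_2) : (0 < a)%N -> bihomog a b s ->
  exists2 v, v != 0 & evp s (v, w) = 0.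
Proof.
move=> a0 hs; pose e0 : 'rV[K]_2 := delta_mx ord0 ord0.
pose e1 : 'rV[K]_2 := delta_mx ord0 ord_max.
pose g := univariate s (e0, w) (xi ord_max); pose g' := univariate s (e1, w) (xi ord0).
have gE t : g.[t] = evp s (e0 + t *: e1, w) by exact: horner_univariate.
have g'E t : g'.[t] = evp s (e1 + t *: e0, w) by exact: horner_univariate.
have [/closed_rootP[t]|] := boolP (size g != 1%N).
  rewrite rootE gE => /eqP st; exists (e0 + t *: e1) => //.
  apply/eqP => /rowP/(_ ord0); rewrite !mxE /= mulr0 addr0 => /eqP.
  by rewrite oner_eq0.
rewrite negbK => /size_poly1P[c c0 gc]; exists e1.
  by apply/eqP => /rowP/(_ ord_max); rewrite !mxE /= => /eqP; rewrite oner_eq0.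
have g'X : g' = c *: 'X^a.
  apply/eqP; rewrite -subr_eq0; apply/eqP.
  apply: (@poly_eq0_generic _ _ 'X); first by rewrite polyX_eq0.
  move=> t; rewrite hornerX => t0; rewrite hornerD hornerN hornerZ hornerXn g'E.
  have -> : e1 + t *: e0 = t *: (e0 + t^-1 *: e1).
    by rewrite scalerDr scalerA divff // scale1r addrC.
  have := evp_scale t 1 (e0 + t^-1 *: e1, w) hs; rewrite /= scale1r => ->.
  by rewrite -gE gc hornerC expr1n mulr1 mulrC subrr.
have := g'E 0; rewrite scale0r addr0 g'X => <-.
by rewrite hornerZ hornerXn expr0n eqn0Ngt a0 mulr0.
Qed.

End Unip.

(** * Fibres of the second projection are not contained in Z *)

Section Fibers.

Variable K : closedFieldType.
Hypothesis char0 : forall n, n.+1%:R != 0 :> K.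

Local Notation S := {mpoly K[2 + 2]}.
Local Notation pt := ('rV[K]_2 * 'rV[K]_2)%type.

Variables (F : S) (d e : nat).
Hypotheses (d_gt0 : (0 < d)%N) (e_gt0 : (0 < e)%N).
Hypotheses (hF : bihomog d e F) (hZ : smooth F).

Implicit Types (s h : S) (p q : pt) (i j : 'I_2).

(** Homogeneity reaches every u with u_i nonzero. The remaining u are limits: F restricted to the
    line through u in direction i vanishes for all t <> 0, hence also at t = 0. *)
Lemma fiber_chart i (v w : 'rV[K]_2) : v ord0 i != 0 ->
  (forall t, evp F (v + t *: delta_mx ord0 (rev_ord i), w) = 0) ->
  forall u, evp F (u, w) = 0.
Proof.
move=> vi h.
have h' (u : 'rV[K]_2) : u ord0 i != 0 -> evp F (u, w) = 0.
  move=> ui; pose c := u ord0 i / v ord0 i.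
  have c0 : c != 0 by rewrite mulf_neq0 ?invr_eq0.
  pose t := c^-1 * u ord0 (rev_ord i) - v ord0 (rev_ord i).
  have uE : u = c *: (v + t *: delta_mx ord0 (rev_ord i)).
    apply/rowP; apply: (@forall_ord2 _ i); rewrite !mxE ?eqxx /=.
      by rewrite [i == _]eq_sym rev_ord_neq mulr0 addr0 /c divfK.
    by rewrite ?eqxx mulr1 /t addrC subrK mulrA divff ?mul1r.
  have := evp_scale c 1 (v + t *: delta_mx ord0 (rev_ord i), w) hF.
  by rewrite /= scale1r -uE => ->; rewrite h mulr0.
move=> u; have [ui|] := eqVneq (u ord0 i) 0; last exact: h'.
have g0 : univariate F (u, w) (xi i) = 0.
  apply: (@poly_eq0_generic _ _ 'X); first by rewrite polyX_eq0.
  move=> t; rewrite hornerX => t0; rewrite horner_univariate /=; apply: h'.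
  by rewrite !mxE !eqxx /= ui add0r mulr1.
have := horner_univariate F (u, w) i 0; rewrite g0 horner0 /= scale0r addr0.
by move=> <-.
Qed.

(* If the fibre over w lay in Z, a zero of F_y' on it would be singular. *)
Lemma fiber_neq0 (w : 'rV[K]_2) : w != 0 -> ~ (forall v, evp F (v, w) = 0).
Proof.
move=> w0 h; have [j wj] := neq0_coord w0.
have [v v0 Gv] := form_zero w d_gt0 (bihomog_derivy (i := rev_ord j) hF).
have [i vi] := neq0_coord v0.
have [] := smooth_at hF hZ (p := (v, w)) vi wj (h v); last by rewrite Gv eqxx.
have g0 : univariate F (v, w) (xi (rev_ord i)) = 0.
  by apply: poly_horner_eq0 => t; rewrite horner_univariate.
have := horner_univariate F^`M(xi (rev_ord i)) (v, w) (rev_ord i) 0.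
by rewrite -deriv_univariate g0 deriv0 horner0 /= scale0r addr0 => <-; rewrite eqxx.
Qed.

Lemma finite_ord_liney i j p :
  p.1 ord0 i != 0 -> p.2 ord0 j != 0 -> evp F p = 0 ->
  exists k, vanish_at F i j p k (line yi p.2) /\
    evp (iter k (delta F i j) (line yi p.2)) p != 0.
Proof.
move=> pi pj Fp; set ly := line yi p.2.
have [[k hk]|nex] := classic (exists k, evp (iter k (delta F i j) ly) p != 0).
  have ex : exists k, evp (iter k (delta F i j) ly) p != 0 by exists k.
  exists (ex_minn ex); case: ex_minnP => m hm min; split=> // l lm.
  by apply/eqP/negPn/negP => /min; rewrite leqNgt lm.
(* The sections vanishing to infinite order at p form an ideal I stable under
   delta.  As ly is in I, so is F_x', hence I is stable under d_x', and all
   x'-derivatives of F vanish at p: the fibre through p lies in Z. *)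
exfalso; pose I s := forall k, vanish_at F i j p k s.
have Ily : I ly.
  move=> k l _; apply/eqP/negPn/negP => hl; apply: nex; by exists l.
have Idelta s : I s -> I (delta F i j s).
  by move=> Is k; have /vanishS[] := Is k.+1.
have Icancel h s : evp h p != 0 -> I (h * s) -> I s.
  by move=> hp Ihs k; apply: (vanish_unitM (@deltaM _ F i j) hp); exact: Ihs.
have IM h s : I s -> I (h * s).
  by move=> Is k; apply: vanishMl => //; [exact: deltaM | exact: Is].
have IFx : I F^`M(xi (rev_ord i)).
  have := Idelta _ Ily; rewrite delta_liney => h.
  apply: (Icancel (- (chart_sign K j * p.2 ord0 j)%:MP)).
    by rewrite evpN oppr_eq0 evpC mulf_neq0 ?chart_sign_neq0.
  by rewrite mulNr mul_mpolyC.
have Fxp : evp F^`M(xi (rev_ord i)) p = 0 by exact: (IFx 1%N 0%N).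
have Fyp : evp F^`M(yi (rev_ord j)) p != 0.
  by have [|//] := smooth_at hF hZ pi pj Fp; rewrite Fxp eqxx.
have Ideriv s : I s -> I s^`M(xi (rev_ord i)).
  move=> Is; apply: (Icancel _ _ Fyp).
  have -> : F^`M(yi (rev_ord j)) * s^`M(xi (rev_ord i)) =
    delta F i j s + s^`M(yi (rev_ord j)) * F^`M(xi (rev_ord i)).
    by rewrite /delta; ring.
  by move=> k; apply: vanishD; [exact: Idelta | exact: IM].
have g0 : univariate F (p.1, p.2) (xi (rev_ord i)) = 0.
  apply: (@derivn_horner_eq0 _ _ 0) => // n.
  have -> : (univariate F (p.1, p.2) (xi (rev_ord i)))^`(n) =
      univariate (iter n (mderiv (xi (rev_ord i))) F) (p.1, p.2) (xi (rev_ord i)).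
    by elim: n => // n IHn; rewrite derivnS IHn deriv_univariate.
  rewrite horner_univariate /= scale0r addr0 -surjective_pairing.
  have : I (iter n (mderiv (xi (rev_ord i))) F).
    by elim: n => [k|n IHn] /=; [exact: vanish_at_self | exact: Ideriv].
  by move/(_ 1%N 0%N); apply.
apply: (@fiber_neq0 p.2); first by apply: contraNneq pj => ->; rewrite mxE.
apply: (fiber_chart pi) => t.
by have := horner_univariate F (p.1, p.2) (rev_ord i) t; rewrite g0 horner0 => <-.
Qed.

End Fibers.

(** * Plane curves as polynomials in one variable over the other *)

Section BivariatePoly.

Variable K : closedFieldType.
Hypothesis char0 : forall n, n.+1%:R != 0 :> K.

Definition proots (f : {poly K}) : seq K := sval (closed_field_poly_normal f).

Lemma mem_proots (f : {poly K}) t : f != 0 -> f.[t] = 0 -> t \in proots f.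
Proof.
rewrite /proots; case: (closed_field_poly_normal f) => r /= fE f0 ft.
have : root f t by rewrite rootE ft.
by rewrite fE rootZ ?lead_coef_eq0 // root_prod_XsubC.
Qed.

(** One-variable Nullstellensatz with an explicit exponent: each linear factor of f divides g, and
    there are at most [size f] of them. An exponent independent of the fibre is what the later
    pseudo-division needs. *)
Lemma dvdp_exp_size (f g : {poly K}) :
  f != 0 -> (forall t, f.[t] = 0 -> g.[t] = 0) -> f %| g ^+ size f.
Proof.
move=> f0 h; case: (closed_field_poly_normal f) => r fE.
have sr : (size r <= size f)%N.
  by rewrite fE size_scale ?lead_coef_eq0 // size_prod_XsubC.
apply: dvdp_trans (dvdp_exp2l _ sr).
have rg z : z \in r -> 'X - z%:P %| g.
  move=> zr; rewrite dvdp_XsubCl rootE h //.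
  by apply/eqP; rewrite -rootE fE rootZ ?lead_coef_eq0 // root_prod_XsubC.
rewrite fE dvdpZl ?lead_coef_eq0 //; elim: r {fE sr} rg => [|z r IHr] rg.
  by rewrite big_nil dvd1p.
rewrite big_cons exprS; apply: dvdp_mul; first by apply: rg; rewrite inE eqxx.
by apply: IHr => y yr; apply: rg; rewrite inE yr orbT.
Qed.

Implicit Types (f g h : {poly {poly K}}) (t x : K).

(** Convention from here on: t is the outer variable, x the variable of the coefficients. Fixing x
    first gives a polynomial over K, to which root-finding applies. *)
Lemma horner_at2 f t x : (map_poly (horner_eval x) f).[t] = f.[t%:P].[x].
Proof. by rewrite -[t in LHS](hornerC t x) -/(horner_eval x _) horner_map. Qed.

Lemma generic_root g x : (1 < size g)%N -> (lead_coef g).[x] != 0 ->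
  exists t, g.[t%:P].[x] = 0.
Proof.
move=> sg lg; have : size (map_poly (horner_eval x) g) != 1%N.
  by rewrite size_map_poly_id0 //; case: (size g) sg => // -[].
by move=> /closed_rootP[t]; rewrite rootE horner_at2 => /eqP; exists t.
Qed.

(** The scalar c is there because division over K[x] works only up to such factors. The point is
    taken over an x where c and the leading coefficient of g are both nonzero: then c can be
    cancelled, and g keeps its degree in t and so has a root. *)
Lemma singular_square f g h (c : {poly K}) :
  c != 0 -> c *: f = g * g * h -> (1 < size g)%N ->
  exists t x, [/\ f.[t%:P].[x] = 0, f^`().[t%:P].[x] = 0 & f.[t%:P]^`().[x] = 0].
Proof.
move=> c0 cf sg; have g0 : lead_coef g != 0 by rewrite lead_coef_eq0 -size_poly_gt0; lia.
have [x] := poly_nonroot (mulf_neq0 c0 g0).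
rewrite hornerM mulf_eq0 negb_or => /andP[cx gx].
have [t gtx] := generic_root sg gx; exists t, x.
have cancel z : c.[x] * z = 0 -> z = 0.
  by move/eqP; rewrite mulf_eq0 (negPf cx) => /eqP.
have fE : c * f.[t%:P] = g.[t%:P] * g.[t%:P] * h.[t%:P].
  by rewrite -(hornerZ c f) cf !hornerM.
have f0 : f.[t%:P].[x] = 0.
  by apply: cancel; rewrite -hornerM fE !hornerM gtx !mul0r.
split=> //; apply: cancel.
  have f'E : c * f^`().[t%:P] = (g * g * h)^`().[t%:P] by rewrite -cf derivZ hornerZ.
  rewrite -hornerM f'E !derivM !(hornerM, hornerD) gtx.
  by rewrite !(mulr0, mul0r, addr0).
have := congr1 (fun q => q^`().[x]) fE; rewrite !derivM !(hornerM, hornerD) gtx f0.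
by rewrite !(mulr0, mul0r, addr0, add0r).
Qed.

(* A common factor of f and its derivative yields a square factor g ^ 2 of a
   multiple of f, and f is singular at the zeros of g. *)
Lemma affine_disc f :
  (forall t x, f.[t%:P].[x] = 0 -> f^`().[t%:P].[x] = 0 -> f.[t%:P]^`().[x] <> 0) ->
  exists2 r : {poly K}, r != 0 &
    forall t x, f.[t%:P].[x] = 0 -> f^`().[t%:P].[x] = 0 -> r.[x] = 0.
Proof.
move=> sm; have f0 : f != 0.
  by apply/eqP => f0; apply: (sm 0 0); rewrite f0 ?deriv0 !horner0 ?deriv0 ?horner0.
have : separable_poly f.
  apply/separable_polyP; split=> [u v|u _ su].
    case/Pdiv.Idomain.dvdpP => -[c w] /= c0 fE; apply/negPn/negP => ncop.
    pose g := gcdp u v.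
    have gn0 : g != 0.
      apply: contraNneq f0 => /eqP; rewrite gcdp_eq0 => /andP[/eqP u0 _].
      by move/eqP: fE; rewrite u0 mul0r mulr0 -mul_polyC mulf_eq0 polyC_eq0 (negPf c0).
    have sg : (1 < size g)%N.
      have g1 : size g != 1%N by rewrite coprimep_def in ncop.
      have := size_poly_gt0 g; rewrite gn0; lia.
    have /Pdiv.Idomain.dvdpP[[c1 u'] /= c1n0 uE] := dvdp_gcdl u v.
    have /Pdiv.Idomain.dvdpP[[c2 v'] /= c2n0 vE] := dvdp_gcdr u v.
    have [] := @singular_square f g (w * u' * v') (c1 * c2 * c) _ _ sg.
    - by rewrite !mulf_neq0.
    - rewrite -scalerA fE -mul_polyC polyCM.
      have -> : c1%:P * c2%:P * (w * (u * v)) = w * (c1%:P * u) * (c2%:P * v) by ring.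
      by rewrite !mul_polyC uE vE -/g; ring.
    by move=> t [x [e1 e2 e3]]; exact: sm e1 e2 e3.
  (* Separability also asks that no nonconstant divisor has derivative 0; in characteristic 0 its
     leading coefficient survives. *)
  apply/eqP => /polyP/(_ (size u).-2); rewrite coef_deriv coef0.
  have -> : (size u).-2.+1 = (size u).-1 by lia.
  rewrite -/(lead_coef u) -scaler_nat => /eqP; rewrite scaler_eq0 lead_coef_eq0.
  have -> : (size u).-1 = (size u).-2.+1 by lia.
  rewrite (negPf (char0 _)) /=.
  by move=> /eqP u0; rewrite u0 size_poly0 in su.
(* Bezout with denominators cleared: up to a scalar, a combination of f and its derivative is the
   nonzero c2 in K[x]. It plays the part of the discriminant and vanishes under every common
   zero. *)
move=> sep; have /Bezout_coprimepP[[u v] /= /eqpP[[c1 c2] /= /andP[_ c2n0] uvE]] :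
  coprimep f f^`() by move: sep; rewrite unlock.
exists c2 => // t x f0tx f'0tx.
have := congr1 (fun q : {poly {poly K}} => q.[t%:P]) uvE.
rewrite !hornerZ hornerD !hornerM -polyC1 hornerC mulr1 => /(congr1 (fun q => q.[x])).
by rewrite !(hornerM, hornerD) f0tx f'0tx !mulr0 addr0 mulr0 => <-.
Qed.

Lemma horner_eval0P f x : map_poly (horner_eval x) f = 0 ->
  exists f1, f = ('X - x%:P)%:P * f1.
Proof.
move=> fx; exists (\poly_(i < size f) (f`_i %/ ('X - x%:P))).
apply/polyP => i; rewrite coefCM coef_poly; case: ltnP => [_|si]; last first.
  by rewrite mulr0 nth_default.
rewrite mulrC divpK // dvdp_XsubCl rootE.
by have := congr1 (fun q : {poly K} => q`_i) fx;
  rewrite coef_map coef0 /= /horner_eval => ->.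
Qed.

(* The content of c is removed one linear factor at a time: where c vanishes so
   does q, since f does not. *)
Lemma strip_content f g n m (c : {poly K}) q t x :
  map_poly (horner_eval x) f != 0 -> (size c <= n)%N -> c != 0 ->
  c *: g ^+ m = q * f -> f.[t%:P].[x] = 0 -> g.[t%:P].[x] = 0.
Proof.
move=> fx; elim: n c q => [|n IHn] c q sc c0 cE ftx.
  by move: sc c0; rewrite leqn0 size_poly_eq0 => ->.
have [/eqP/factor_theorem[c' c'E]|cx] := eqVneq c.[x] 0; last first.
  have := congr1 (fun h : {poly {poly K}} => h.[t%:P].[x]) cE.
  rewrite hornerZ !hornerM ftx mulr0 horner_exp horner_exp => /eqP.
  by rewrite mulf_eq0 (negPf cx) expf_eq0 => /andP[_ /eqP].
have qx : map_poly (horner_eval x) q = 0.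
  have := congr1 (map_poly (horner_eval x)) cE; rewrite map_polyZ rmorphM /=.
  rewrite /horner_eval c'E hornerM hornerXsubC subrr mulr0 scale0r => /esym/eqP.
  by rewrite mulf_eq0 (negPf fx) orbF => /eqP.
have [q' q'E] := horner_eval0P qx.
have Xx0 : 'X - x%:P != 0 :> {poly K} by rewrite polyXsubC_eq0.
have c'0 : c' != 0 by apply: contraNneq c0 => c'0; rewrite c'E c'0 mul0r.
apply: (IHn c' q') => //.
  by move: sc; rewrite c'E size_Mmonic ?monicXsubC // size_XsubC addn2.
apply: (mulfI (x := ('X - x%:P)%:P)); first by rewrite polyC_eq0.
by rewrite mulrA -q'E -cE c'E [in RHS]mulrC -scalerA mul_polyC.
Qed.

(* Pseudo-divide a power of g by f: the remainder vanishes for generic x. *)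
Lemma vanish_generic f g (r : {poly K}) :
  r != 0 -> (forall x, map_poly (horner_eval x) f != 0) ->
  (forall t x, r.[x] != 0 -> f.[t%:P].[x] = 0 -> g.[t%:P].[x] = 0) ->
  forall t x, f.[t%:P].[x] = 0 -> g.[t%:P].[x] = 0.
Proof.
move=> r0 fx h t x.
have f0 : f != 0 by apply: contraNneq (fx 0) => ->; rewrite rmorph0.
have := Pdiv.Idomain.divp_eq (g ^+ size f) f.
set c := _ ^+ scalp _ _; set q := _ %/ _; set rem := _ %% _ => cE.
have c0 : c != 0 by rewrite expf_neq0 ?lead_coef_eq0.
have srem : (size rem < size f)%N by rewrite ltn_modp.
move: c q rem cE c0 srem => c q rem cE c0 srem.
suff rem0 : rem = 0.
  by rewrite rem0 addr0 in cE; apply: strip_content (fx x) (leqnn _) c0 cE.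
(* Over such a y all roots of the specialized f are roots of g, so f divides the chosen power of g
   and therefore the remainder. Since f keeps its degree there, the remainder is too small to be
   nonzero. *)
have remy y : (r * lead_coef f).[y] != 0 -> map_poly (horner_eval y) rem = 0.
  rewrite hornerM mulf_eq0 negb_or => /andP[ry ly].
  set fy := map_poly (horner_eval y) f.
  have sfy : size fy = size f by rewrite size_map_poly_id0.
  have fy_g : fy %| map_poly (horner_eval y) g ^+ size f.
    rewrite -sfy; apply: dvdp_exp_size => [|z]; first exact: fx.
    by rewrite !horner_at2; exact: h.
  have : fy %| map_poly (horner_eval y) rem.
    have -> : rem = c *: g ^+ size f - q * f by rewrite cE addrAC subrr add0r.
    rewrite rmorphB /= map_polyZ rmorphXn rmorphM /= -/fy.
    by apply: dvdp_sub; [rewrite -mul_polyC dvdp_mull | exact: dvdp_mulIr].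
  move=> /dvdp_leq; case: eqVneq => // _ /(_ isT); rewrite sfy leqNgt.
  by rewrite (leq_ltn_trans (size_poly _ _)).
apply/polyP => i; rewrite coef0.
apply: (@poly_eq0_generic _ _ (r * lead_coef f)).
  by rewrite mulf_neq0 ?lead_coef_eq0.
move=> y /remy/(congr1 (fun p : {poly K} => p`_i)); by rewrite coef_map coef0.
Qed.

End BivariatePoly.

(** * Exchange of the two factors *)

Section Swap.

Variable K : closedFieldType.

Local Notation S := {mpoly K[2 + 2]}.

Definition swap_idx (k : 'I_(2 + 2)) : 'I_(2 + 2) :=
  match split k with inl i => yi i | inr i => xi i end.

Lemma swap_xi i : swap_idx (xi i) = yi i.
Proof. by rewrite /swap_idx /xi -[lshift 2 i]/(unsplit (inl i)) unsplitK. Qed.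

Lemma swap_yi i : swap_idx (yi i) = xi i.
Proof. by rewrite /swap_idx /yi -[rshift 2 i]/(unsplit (inr i)) unsplitK. Qed.

Lemma swap_idxK : involutive swap_idx.
Proof.
move=> k; case: (split_ordP k) => i ->.
  by rewrite -/(xi i) swap_xi swap_yi.
by rewrite -/(yi i) swap_yi swap_xi.
Qed.

Definition swap (s : S) : S := mmap (@mpolyC (2 + 2) K) (fun k => 'X_(swap_idx k)) s.

Lemma evp_swap s v w : evp (swap s) (w, v) = evp s (v, w).
Proof.
rewrite /evp /swap {1}/meval rmorph_mmap; apply: eq_mmap => [c|k] /=.
  exact: mevalC.
rewrite -/(meval _ _) mevalXU; case: (split_ordP k) => i ->.
  by rewrite -/(xi i) swap_xi row_mxEr row_mxEl.
by rewrite -/(yi i) swap_yi row_mxEr row_mxEl.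
Qed.

Lemma swap_deriv s k : (swap s)^`M(swap_idx k) = swap s^`M(k).
Proof.
rewrite /swap (mmap_deriv _ _ (D := mderiv (swap_idx k))); first last.
- exact: mderivC.
- exact: mderivM.
- exact: mderivD.
rewrite (bigD1 k) //= mderivXU eqxx mul1r big1 ?addr0 // => l /negPf lk.
by rewrite mderivXU (inj_eq (can_inj swap_idxK)) lk mul0r.
Qed.

Lemma bihomog_prod (c c' : nat) (I : Type) (r : seq I) (f : I -> S) (m : I -> nat) :
  (forall i, bihomog c c' (f i)) ->
  bihomog (c * (\sum_(i <- r) m i)) (c' * (\sum_(i <- r) m i)) (\prod_(i <- r) f i ^+ m i).
Proof.
move=> hf; elim: r => [|i r IHr]; first by rewrite !big_nil !muln0; exact: bihomogC.
by rewrite !big_cons !mulnDr; apply: bihomogM => //; exact: bihomogXn.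
Qed.

Lemma bihomog_swap a b s : bihomog a b s -> bihomog b a (swap s).
Proof.
move=> hs; rewrite /swap /mmap big_seq; apply: bihomog_sum => m ms.
rewrite mul_mpolyC; apply: bihomogZ.
rewrite /mmap1 big_split_ord /=.
under eq_bigr do rewrite -/(xi _) swap_xi.
under [X in _ * X]eq_bigr do rewrite -/(yi _) swap_yi.
have [<- <-] := hs m ms.
have := bihomogM
  (@bihomog_prod _ _ _ (index_enum _) _ (fun i => m (xi i)) (@bihomogY K))
  (@bihomog_prod _ _ _ (index_enum _) _ (fun i => m (yi i)) (@bihomogX K)).
by rewrite !mul0n !mul1n addn0 add0n.
Qed.

Lemma smooth_swap F : smooth F -> smooth (swap F).
Proof.
move=> sm i j [v w] /= vi wj; rewrite evp_swap => Fp.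
have -> : xi (rev_ord i) = swap_idx (yi (rev_ord i)) by rewrite swap_yi.
have -> : (swap F)^`M(yi (rev_ord j)) = swap F^`M(xi (rev_ord j)).
  by rewrite -swap_deriv swap_xi.
rewrite swap_deriv !evp_swap.
by have [] := sm j i (w, v) wj vi Fp; [right | left].
Qed.

End Swap.

Section Bivariate.

Variable K : closedFieldType.

Local Notation S := {mpoly K[2 + 2]}.
Local Notation pt := ('rV[K]_2 * 'rV[K]_2)%type.

Implicit Types (s : S) (k l : 'I_(2 + 2)) (t x : K).

(** Dehomogenization: k becomes the outer variable, l the inner one, and the coordinates normalizing
    the chart become 1. Keeping k and l as parameters lets the same discriminant argument run in
    either direction. *)
Definition bivariate s k l : {poly {poly K}} :=
  mmap (@polyC {poly K} \o @polyC K)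
    (fun m => if m == k then 'X else if m == l then 'X%:P else 1) s.

Lemma horner_bivariate s k l t :
  (bivariate s k l).[t%:P] =
  mmap (@polyC K) (fun m => if m == k then t%:P else if m == l then 'X else 1) s.
Proof.
rewrite -horner_evalE /bivariate rmorph_mmap; apply: eq_mmap => [c|m] /=.
  by rewrite horner_evalE hornerC.
rewrite horner_evalE; case: ifP => _; first by rewrite hornerX.
by case: ifP => _; rewrite ?hornerC // -polyC1 hornerC.
Qed.

Lemma horner2_bivariate s k l t x :
  (bivariate s k l).[t%:P].[x] = s.@[fun m =>
    if m == k then t else if m == l then x else 1].
Proof.
rewrite horner_bivariate -horner_evalE rmorph_mmap; apply: eq_mmap => [c|m] /=.
  by rewrite horner_evalE hornerC.
rewrite horner_evalE; case: ifP => _; first by rewrite hornerC.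
by case: ifP => _; rewrite ?hornerX // -polyC1 hornerC.
Qed.

Lemma deriv_bivariate s k l : (bivariate s k l)^`() = bivariate s^`M(k) k l.
Proof.
rewrite /bivariate (mmap_deriv _ _ (D := @deriv {poly K})); first last.
- by move=> c; exact: derivC.
- exact: derivM.
- exact: derivD.
rewrite (bigD1 k) //= eqxx derivX mul1r big1 ?addr0 // => m /negPf mk.
by rewrite mk; case: ifP => _; rewrite ?derivC -?polyC1 ?derivC mul0r.
Qed.

Lemma deriv_horner_bivariate s k l t : l != k ->
  (bivariate s k l).[t%:P]^`() = (bivariate s^`M(l) k l).[t%:P].
Proof.
move=> /negPf lk; rewrite !horner_bivariate (mmap_deriv _ _ (D := @deriv K)); first last.
- exact: derivC.
- exact: derivM.
- exact: derivD.
rewrite (bigD1 l) //= eqxx lk derivX mul1r big1 ?addr0 // => m /negPf ml.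
by rewrite ml; case: ifP => _; rewrite -?polyC1 ?derivC mul0r.
Qed.

Definition chart_point (i j : 'I_2) t x : pt :=
  (\row_k (if k == i then 1 else t), \row_k (if k == j then 1 else x)).

Lemma neq_rev_ord (i k : 'I_2) : (k == rev_ord i) = (k != i).
Proof. by case: (ord2P i) => -[-> ->]; case: (ord2P k) => -[-> _]. Qed.

Lemma evp_chart_point_x s i j t x :
  evp s (chart_point i j t x) =
    (bivariate s (xi (rev_ord i)) (yi (rev_ord j))).[t%:P].[x].
Proof.
rewrite horner2_bivariate; apply: meval_eq => k; case: (split_ordP k) => l -> /=.
  by rewrite row_mxEl mxE -/(xi l) !idxE neq_rev_ord; case: (l == i).
by rewrite row_mxEr mxE -/(yi l) !idxE neq_rev_ord; case: (l == j).
Qed.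

Lemma evp_chart_point_y s i j t x :
  evp s (chart_point i j t x) =
    (bivariate s (yi (rev_ord j)) (xi (rev_ord i))).[x%:P].[t].
Proof.
rewrite horner2_bivariate; apply: meval_eq => k; case: (split_ordP k) => l -> /=.
  by rewrite row_mxEl mxE -/(xi l) !idxE neq_rev_ord; case: (l == i).
by rewrite row_mxEr mxE -/(yi l) !idxE neq_rev_ord; case: (l == j).
Qed.

Lemma chart_point1 i j t x : (chart_point i j t x).1 ord0 i = 1.
Proof. by rewrite mxE eqxx. Qed.

Lemma chart_point2 i j t x : (chart_point i j t x).2 ord0 j = 1.
Proof. by rewrite mxE eqxx. Qed.

Lemma chart_pointE i j (p : pt) : p.1 ord0 i = 1 -> p.2 ord0 j = 1 ->
  p = chart_point i j (p.1 ord0 (rev_ord i)) (p.2 ord0 (rev_ord j)).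
Proof.
case: p => v w /= vi wj; congr (_, _); apply/rowP.
  by apply: (@forall_ord2 _ i); rewrite mxE ?eqxx ?rev_ord_neq.
by apply: (@forall_ord2 _ j); rewrite mxE ?eqxx ?rev_ord_neq.
Qed.

Lemma chart_pointD1 i j t x : (chart_point i j t x).1 = (chart_point i j 0 x).1 + t *:
  delta_mx ord0 (rev_ord i).
Proof.
apply/rowP; apply: (@forall_ord2 _ i); rewrite !mxE !eqxx ?rev_ord_neq /=.
  by rewrite [i == _]eq_sym rev_ord_neq mulr0 addr0.
by rewrite mulr1 add0r.
Qed.

Lemma chart_pointD2 i j t x : (chart_point i j t x).2 = (chart_point i j t 0).2 + x *:
  delta_mx ord0 (rev_ord j).
Proof.
apply/rowP; apply: (@forall_ord2 _ j); rewrite !mxE !eqxx ?rev_ord_neq /=.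
  by rewrite [j == _]eq_sym rev_ord_neq mulr0 addr0.
by rewrite mulr1 add0r.
Qed.

End Bivariate.

(** * Finiteness of ramification and density of the unramified points *)

Section Generic.

Variable K : closedFieldType.
Hypothesis char0 : forall n, n.+1%:R != 0 :> K.

Local Notation S := {mpoly K[2 + 2]}.
Local Notation pt := ('rV[K]_2 * 'rV[K]_2)%type.

Variables (F : S) (d e : nat).
Hypotheses (d_gt0 : (0 < d)%N) (e_gt0 : (0 < e)%N).
Hypotheses (hF : bihomog d e F) (hZ : smooth F).

Implicit Types (p q : pt) (i j : 'I_2).

Lemma fiber_x i j x :
  map_poly (horner_eval x) (bivariate F (xi (rev_ord i)) (yi (rev_ord j))) != 0.
Proof.
apply/eqP => f0; apply: (@fiber_neq0 _ _ _ _ d_gt0 hF hZ (chart_point i j 0 x).2).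
  by apply/eqP => /rowP/(_ j); rewrite chart_point2 mxE => /eqP; rewrite oner_eq0.
apply: (fiber_chart hF (i := i) (v := (chart_point i j 0 x).1)).
  by rewrite chart_point1 oner_eq0.
move=> t; rewrite -chart_pointD1.
have := evp_chart_point_x F i j t x; rewrite -horner_at2 f0 horner0; exact.
Qed.

Lemma fiber_y i j t : (bivariate F (xi (rev_ord i)) (yi (rev_ord j))).[t%:P] != 0.
Proof.
apply/eqP => f0.
apply: (@fiber_neq0 _ _ _ _ e_gt0 (bihomog_swap hF) (smooth_swap hZ) (chart_point i j t 0).1).
  by apply/eqP => /rowP/(_ i); rewrite chart_point1 mxE => /eqP; rewrite oner_eq0.
apply: (fiber_chart (bihomog_swap hF) (i := j) (v := (chart_point i j t 0).2)).
  by rewrite chart_point2 oner_eq0.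
move=> x; rewrite -chart_pointD2 evp_swap.
have := evp_chart_point_x F i j t x; rewrite f0 horner0; exact.
Qed.

Lemma disc_x i j : exists2 r : {poly K}, r != 0 & forall t x,
  evp F (chart_point i j t x) = 0 -> evp F^`M(xi (rev_ord i)) (chart_point i j t x) =
    0 -> r.[x] = 0.
Proof.
have [|r r0 hr] := affine_disc char0 (f := bivariate F (xi (rev_ord i)) (yi (rev_ord j))).
  move=> t x;
    rewrite deriv_bivariate deriv_horner_bivariate ?idxE // -!evp_chart_point_x =>
      Fp Fx Fy.
  by have [] := hZ (chart_point1 i j t x) (chart_point2 i j t x) Fp; rewrite ?Fx ?Fy eqxx.
by exists r => // t x Fp Fx; apply: (hr t); rewrite ?deriv_bivariate -evp_chart_point_x.
Qed.

Lemma disc_y i j : exists2 r : {poly K}, r != 0 & forall t x,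
  evp F (chart_point i j t x) = 0 -> evp F^`M(yi (rev_ord j)) (chart_point i j t x) =
    0 -> r.[t] = 0.
Proof.
have [|r r0 hr] := affine_disc char0 (f := bivariate F (yi (rev_ord j)) (xi (rev_ord i))).
  move=> x t;
    rewrite deriv_bivariate deriv_horner_bivariate ?idxE // -!evp_chart_point_y =>
      Fp Fy Fx.
  by have [] := hZ (chart_point1 i j t x) (chart_point2 i j t x) Fp; rewrite ?Fx ?Fy eqxx.
by exists r => // t x Fp Fy; apply: (hr x); rewrite ?deriv_bivariate -evp_chart_point_y.
Qed.

Lemma finite_branch i j : exists L : seq pt, forall t x,
  evp F (chart_point i j t x) = 0 -> evp F^`M(xi (rev_ord i)) (chart_point i j t x) = 0 ->
  chart_point i j t x \in L.
Proof.
have [r r0 hr] := disc_x i j.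
pose f x := map_poly (horner_eval x) (bivariate F (xi (rev_ord i)) (yi (rev_ord j))).
exists [seq chart_point i j t x | x <- proots r, t <- proots (f x)] => t x Fp Fx.
have xr : x \in proots r by apply: mem_proots => //; exact: hr Fp Fx.
apply/allpairsPdep; exists x, t; split=> //.
apply: mem_proots; first exact: fiber_x.
by rewrite horner_at2 -evp_chart_point_x.
Qed.

(** The zeros of F_y' are bounded by a condition on t, whereas one on x is wanted. It is transferred
    by multiplying in F(t, x) for each of the finitely many bad t; these factors are nonzero because
    Z contains no fibre of the first projection either. *)
Lemma disc_xy i j : exists2 r : {poly K}, r != 0 & forall t x,
  evp F (chart_point i j t x) = 0 -> r.[x] != 0 ->
  evp F^`M(xi (rev_ord i)) (chart_point i j t x) != 0 /\
  evp F^`M(yi (rev_ord j)) (chart_point i j t x) != 0.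
Proof.
have [r1 r10 hr1] := disc_x i j; have [r2 r20 hr2] := disc_y i j.
pose f t := (bivariate F (xi (rev_ord i)) (yi (rev_ord j))).[t%:P].
exists (r1 * \prod_(t <- proots r2) f t).
  rewrite mulf_neq0 // prodf_seq_neq0; apply/allP => t _; exact: fiber_y.
move=> t x Fp; rewrite hornerM mulf_eq0 negb_or => /andP[r1x fx]; split.
  by apply: contraNneq r1x => Fx; apply/eqP; exact: hr1 Fp Fx.
apply: contraNneq fx => Fy; rewrite horner_prod prodf_seq_eq0; apply/hasP.
exists t; last by rewrite /= /f -evp_chart_point_x Fp.
by apply: mem_proots => //; exact: hr2 Fp Fy.
Qed.

(** This stands for the absence of isolated points: in a chart, the hypothesis covers all points of
    Z over general x, and [vanish_generic] extends the vanishing to the remaining fibres. *)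
Lemma generic_dense a b (f : S) : bihomog a b f ->
  (forall p, onZ F p -> (exists i, evp F^`M(xi i) p != 0) ->
     (exists j, evp F^`M(yi j) p != 0) -> evp f p = 0) ->
  forall p, onZ F p -> evp f p = 0.
Proof.
move=> hf h p [pX Fp].
have [i [j [pi pj]]] := onX_chart pX.
have [pq qi qj] := normalizeP pi pj.
apply/eqP; rewrite -(evp_pt_eq_neq0 hf pq); apply/eqP.
have Fq : evp F (normalize i j p) = 0 by apply/eqP; rewrite (evp_pt_eq_neq0 hF pq) Fp.
move: Fq; rewrite (chart_pointE qi qj) !evp_chart_point_x.
have [r r0 hr] := disc_xy i j.
apply: (vanish_generic r0) => [x|t x rx]; first exact: fiber_x.
rewrite -!evp_chart_point_x => Fc; have [Fx Fy] := hr _ _ Fc rx.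
apply: h; [|by exists (rev_ord i)|by exists (rev_ord j)].
split=> //; split; apply/eqP => /rowP.
  by move/(_ i); rewrite chart_point1 mxE => /eqP; rewrite oner_eq0.
by move/(_ j); rewrite chart_point2 mxE => /eqP; rewrite oner_eq0.
Qed.

End Generic.

(** * The Jacobian linear systems *)

Section RowVectors.

Variable K : closedFieldType.

Lemma proj_eq_cross (v w : 'rV[K]_2) : v != 0 -> w != 0 ->
  (forall i, v ord0 i * w ord0 (rev_ord i) = v ord0 (rev_ord i) * w ord0 i) ->
  proj_eq v w.
Proof.
move=> /neq0_coord[i vi] w0 cross; have wE : w = (w ord0 i / v ord0 i) *: v.
  apply/rowP; apply: (@forall_ord2 _ i); rewrite mxE ?divfK //.
  by apply: (mulfI vi); rewrite cross; field.
exists (w ord0 i / v ord0 i); split=> //.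
by apply: contraNneq w0 => c0; rewrite wE c0 scale0r.
Qed.

Lemma chart_sign_rev (i : 'I_2) : chart_sign K (rev_ord i) = - chart_sign K i.
Proof. by rewrite /chart_sign; case: (ord2P i) => -[-> ->] /=; rewrite ?opprK. Qed.

Lemma chart_sign_sqr (i : 'I_2) : chart_sign K i * chart_sign K i = 1.
Proof. by rewrite /chart_sign; case: ifP => _; rewrite ?mulr1 ?mulrNN ?mulr1. Qed.

(** In the plane, a nonzero vector orthogonal to G is determined up to scale, so q is proportional
    to (G_1, -G_0). The signs [- chart_sign] are exactly 1 and -1. *)
Lemma proj_eq_gradient (q : 'rV[K]_2) (G : 'I_2 -> K) c :
  \sum_(i < 2) q ord0 i * G i = 0 -> q != 0 ->
  \row_i (- chart_sign K i * (c * G (rev_ord i))) != 0 ->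
  proj_eq (\row_i (- chart_sign K i * (c * G (rev_ord i)))) q.
Proof.
move=> qG q0 v0; apply: proj_eq_cross => // i.
rewrite !mxE rev_ordK chart_sign_rev; move: qG; rewrite (sum_ord2 i) => /eqP.
rewrite addr_eq0 => /eqP qG.
have -> : - - chart_sign K i * (c * G i) * q ord0 i =
  chart_sign K i * c * (q ord0 i * G i) by ring.
by rewrite qG; ring.
Qed.

Lemma meval_homogZ n k (g : {mpoly K[n]}) c (v : 'rV[K]_n) :
  g \is k.-homog -> g.@[(c *: v) ord0] = c ^+ k * g.@[v ord0].
Proof.
move=> /dhomogP hg; rewrite !mevalE mulr_sumr big_seq [RHS]big_seq.
apply: eq_bigr => m ms; rewrite mulrCA; congr (_ * _).
have <- : mdeg m = k := hg m ms; rewrite mdegE expr_sum -big_split; apply: eq_bigr =>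
  i _ /=.
by rewrite mxE exprMn.
Qed.

End RowVectors.

Section Main.

Variable K : closedFieldType.
Hypothesis char0 : forall n, n.+1%:R != 0 :> K.

Local Notation S := {mpoly K[2 + 2]}.
Local Notation pt := ('rV[K]_2 * 'rV[K]_2)%type.

Variables (F : S) (d e : nat).
Hypotheses (d_gt1 : (1 < d)%N) (e_gt1 : (1 < e)%N).
Hypotheses (hF : bihomog d e F) (hZ : smooth F).

Local Notation Fx i := (F^`M(xi i)).
Local Notation Fy i := (F^`M(yi i)).

Let d_gt0 : (0 < d)%N := ltnW d_gt1.
Let e_gt0 : (0 < e)%N := ltnW e_gt1.

Implicit Types (p q : pt) (i j : 'I_2).

Lemma hFx i : bihomog d.-1 e (Fx i). Proof. exact: bihomog_derivx. Qed.
Lemma hFy j : bihomog d e.-1 (Fy j). Proof. exact: bihomog_derivy. Qed.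

Lemma jacobian_Fx i : jacobian F d.-1 e (Fx i).
Proof.
split; first exact: hFx.
exists (fun k => (k == xi i)%:R); rewrite (bigD1 (xi i)) //= eqxx mul1r.
by rewrite big1 ?addr0 // => k /negPf->; rewrite mul0r.
Qed.

Lemma jacobianZ a b (c : K) (s : S) : jacobian F a b s -> jacobian F a b (c *: s).
Proof.
case=> hs [f sE]; split; first exact: bihomogZ.
exists (fun k => c *: f k); rewrite sE scaler_sumr; apply: eq_bigr => k _.
by rewrite scalerAl.
Qed.

Lemma jacobian_xspan s : jacobian F d.-1 e s ->
  exists c : 'I_2 -> K, s = \sum_(i < 2) c i *: Fx i.
Proof.
case=> hs [c sE].
exists (fun i => (bipart 0 0 (c (xi i)))@_0%MM).
rewrite -(bipart_id hs) sE linear_sum big_split_ord /= [X in _ + X]big1 ?addr0.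
  apply: eq_bigr => i _; rewrite (bipartM _ _ _ (@hFx i)) !leqnn !subnn /=.
  have [x xE] := bihomog00 (@bipart_bihomog _ 0 0 (c (xi i))).
  by rewrite -/(xi i) xE mcoeffC eqxx mulr1 mul_mpolyC.
move=> j _; rewrite (bipartM _ _ _ (@hFy j)) [(d <= _)%N]leqNgt.
by rewrite prednK ?leqnn.
Qed.

Section AtPoint.

Variables (i j : 'I_2) (p : pt).
Hypotheses (pi : p.1 ord0 i != 0) (pj : p.2 ord0 j != 0) (Fp : evp F p = 0).

Lemma deltaZ (c : K) (s : S) : delta F i j (c *: s) = c *: delta F i j s.
Proof. by rewrite /delta !mderivZ -!scalerAr scalerBr. Qed.

Lemma iter_deltaZ l (c : K) (s : S) : iter l (delta F i j) (c *: s) = c *: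
  iter l (delta F i j) s.
Proof. by elim: l => //= l ->; rewrite deltaZ. Qed.

Lemma iter_delta_liney l : exists2 c, c != 0 &
  evp (iter l.+1 (delta F i j) (line yi p.2)) p =
  c * evp (iter l (delta F i j) (Fx (rev_ord i))) p.
Proof.
exists (- (chart_sign K j * p.2 ord0 j)).
  by rewrite oppr_eq0 mulf_neq0 ?chart_sign_neq0.
by rewrite iterSr delta_liney -scaleNr iter_deltaZ evpZ.
Qed.

Lemma ord_is_liney : exists2 m,
  ord_is F p (line yi p.2) m.+1 & ord_is F p (Fx (rev_ord i)) m.
Proof.
have [[|m] [vm nm]] := finite_ord_liney char0 d_gt0 hF hZ pi pj Fp.
  by move: nm; rewrite /= evp_liney eqxx.
exists m; first by apply/(ord_isP char0 d_gt0 e_gt0 hF hZ pi pj Fp _ (@bihomog_liney _ p.2)).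
apply/(ord_isP char0 d_gt0 e_gt0 hF hZ pi pj Fp _ (@hFx _)); split=> [l lm|].
  have [c c0 cE] := iter_delta_liney l.
  have vl : evp (iter l.+1 (delta F i j) (line yi p.2)) p = 0 := vm l.+1 lm.
  by apply/eqP; move/eqP: vl; rewrite cE mulf_eq0 (negPf c0).
have [c c0 cE] := iter_delta_liney m.
by move: nm; rewrite cE mulf_eq0 negb_or => /andP[].
Qed.

Lemma ord_is_uniq a b s k l : bihomog a b s ->
  ord_is F p s k -> ord_is F p s l -> k = l.
Proof.
move=> hs /(ord_isP char0 d_gt0 e_gt0 hF hZ pi pj Fp _ hs)[vk nk].
move=> /(ord_isP char0 d_gt0 e_gt0 hF hZ pi pj Fp _ hs)[vl nl].
case: (ltngtP k l) => // [kl|lk].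
  by move: nk; rewrite /evp (vl k kl) eqxx.
by move: nl; rewrite /evp (vk l lk) eqxx.
Qed.

(** By Euler's relation x_i F_xi is, modulo F, a multiple of F_x', and x_i is a unit at p. Hence
    F_x' has the least order among all combinations of the two derivatives. *)
Lemma ord_ge_jacobian m s : ord_is F p (Fx (rev_ord i)) m ->
  jacobian F d.-1 e s -> ord_ge F p s m.
Proof.
move=> /(ord_isP char0 d_gt0 e_gt0 hF hZ pi pj Fp _ (@hFx _))[vm _] Js.
have [hs _] := Js; apply: (vanish_at_ord_ge char0 d_gt0 e_gt0 hF hZ pi pj Fp hs).
have [c ->] := jacobian_xspan Js.
have vZ k x (t : S) : vanish_at F i j p k t -> vanish_at F i j p k (x *: t).
  by move=> vt; rewrite -mul_mpolyC; apply: vanishMl => //; exact: deltaM.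
rewrite (sum_ord2 i); apply: vanishD; apply: (vZ) => //.
have xp : evp 'X_(xi i) p != 0 by rewrite evpXx.
apply: (vanish_unitM (@deltaM _ F i j) xp).
have -> : 'X_(xi i) * Fx i = d%:R *: F - 'X_(xi (rev_ord i)) * Fx (rev_ord i).
  by rewrite -(euler_x hF) (sum_ord2 i) addrK.
apply: vanishB; first by apply: vZ; exact: vanish_at_self.
by apply: vanishMl => //; exact: deltaM.
Qed.

End AtPoint.

Lemma line_scale (z : 'I_2 -> 'I_(2 + 2)) (c : K) (v : 'rV[K]_2) :
  line z (c *: v) = c *: line z v.
Proof. by rewrite /line !mxE scalerBr !scalerA. Qed.

Lemma ord_ge_pt_eq p q s k : pt_eq p q -> ord_ge F p s k -> ord_ge F q s k.
Proof.
move=> pq [h [c [[a [b hh]] hp hs]]]; have [[x [x0 qx]] [y [y0 qy]]] := pq.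
exists h, (fun l : 'I_k.+1 => (x ^- l * y ^- (k - l)) *: c l); split;
  first by exists a, b.
  by rewrite (evp_pt_eq_neq0 hh pq).
congr (eq_on F _ _) : hs; apply: eq_bigr => l _; rewrite qx qy !line_scale.
rewrite !exprZn; set lx := _ ^+ l; set ly := _ ^+ (k - l).
transitivity ((x ^- l * x ^+ l * (y ^- (k - l) * y ^+ (k - l))) *: (c l * (lx * ly))).
  by rewrite !mulVf ?expf_neq0 // mulr1 scale1r.
by rewrite -!mul_mpolyC !mpolyCM; ring.
Qed.

Lemma ord_is_pt_eq p q s k : pt_eq p q -> ord_is F p s k -> ord_is F q s k.
Proof.
move=> pq [ge nge]; split; first exact: ord_ge_pt_eq pq ge.
by move/(ord_ge_pt_eq (pt_eq_sym pq)).
Qed.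

(** Common pointwise description from which both the base divisor and the ramification divisor are
    read off. The clause for every admissible i makes it independent of the chart. *)
Definition ramification (D : pt -> nat) : Prop := forall p, onZ F p ->
  ord_is F p (line yi p.2) (D p).+1 /\
  forall i, p.1 ord0 i != 0 -> ord_is F p (Fx (rev_ord i)) (D p).

Lemma ramification_exists : exists D, ramification D.
Proof.
apply: (@functional_choice _ _ (fun p m => onZ F p ->
  ord_is F p (line yi p.2) m.+1 /\
  forall i, p.1 ord0 i != 0 -> ord_is F p (Fx (rev_ord i)) m)) => p.
have [[pX Fp]|nZ] := classic (onZ F p); last by exists 0%N.
have [i [j [pi pj]]] := onX_chart pX.
have [m lym _] := ord_is_liney pi pj Fp; exists m => _; split=> // k pk.
have [m' lym' Fxm'] := ord_is_liney pk pj Fp.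
have := ord_is_uniq pi pj Fp (@bihomog_liney _ p.2) lym lym'.
by case=> ->.
Qed.

Lemma ramification_divisor D : ramification D -> is_divisor F D.
Proof.
move=> hD; split=> [p q pZ qZ pq|].
  have [i [j [pi pj]]] := onX_chart pZ.1.
  have [qi qj] : q.1 ord0 i != 0 /\ q.2 ord0 j != 0.
    case: pq => -[x [x0 ->]] [y [y0 ->]]; rewrite !mxE.
    by rewrite !mulf_neq0.
  have Dp := ord_is_pt_eq pq ((hD p pZ).2 i pi).
  exact: (ord_is_uniq qi qj qZ.2 (@hFx _) Dp ((hD q qZ).2 i qi)).
have [L hL] : exists L : 'I_2 * 'I_2 -> seq pt, forall ij t x,
    evp F (chart_point ij.1 ij.2 t x) = 0 ->
    evp (Fx (rev_ord ij.1)) (chart_point ij.1 ij.2 t x) = 0 ->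
      chart_point ij.1 ij.2 t x \in L ij.
  apply: (@functional_choice _ _ (fun ij l => forall t x,
    evp F (chart_point ij.1 ij.2 t x) = 0 ->
    evp (Fx (rev_ord ij.1)) (chart_point ij.1 ij.2 t x) = 0 ->
      chart_point ij.1 ij.2 t x \in l)).
  by case=> i j; exact: (finite_branch char0 d_gt0 hF hZ).
exists (flatten [seq L ij | ij <- enum {: 'I_2 * 'I_2}]) => p pZ Dp.
have [i [j [pi pj]]] := onX_chart pZ.1.
have [pq qi qj] := normalizeP pi pj; exists (normalize i j p) => //.
apply/flatten_mapP; exists (i, j); first by rewrite mem_enum.
rewrite (chart_pointE qi qj); apply: (hL (i, j)); rewrite /= -(chart_pointE qi qj).
  by apply/eqP; rewrite (evp_pt_eq_neq0 hF pq) pZ.2.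
(* A positive multiplicity forces F_x'(p) = 0, so p is in the finite list of one of the four
   charts. *)
have /(ord_isP char0 d_gt0 e_gt0 hF hZ pi pj pZ.2 _ (@hFx _))[v _] := (hD p pZ).2 i pi.
apply/eqP; rewrite (evp_pt_eq_neq0 (@hFx _) pq); apply/eqP.
by apply: (v 0%N); rewrite lt0n; apply/eqP.
Qed.

Lemma ramification_base D : ramification D ->
  is_base_divisor F (jacobian F d.-1 e) D.
Proof.
move=> hD; split; first exact: ramification_divisor.
move=> p pZ; have [i [j [pi pj]]] := onX_chart pZ.1.
have Fxp := (hD p pZ).2 i pi; split.
  by move=> s; exact: (ord_ge_jacobian pi pj pZ.2 Fxp).
by exists (Fx (rev_ord i)) => //; exact: jacobian_Fx.
Qed.

Lemma ramification_ram D : ramification D -> is_ramification_divisor2 F D.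
Proof.
move=> hD; split; first exact: ramification_divisor.
move=> p pZ; exists (D p).+1; first exact: (hD p pZ).1.
by rewrite subn1.
Qed.

(** Euler's relation evaluated at x = c itself: a G(c, w) is the directional derivative along c at
    that point, and a is invertible. *)
Lemma directional_zero a b (G : S) (c : 'I_2 -> K) (w : 'rV[K]_2) :
  (0 < a)%N -> bihomog a b G -> \sum_(i < 2) c i *: G^`M(xi i) = 0 ->
  evp G (\row_i c i, w) = 0.
Proof.
move=> a0 hG G0; have /(congr1 (fun s => evp s (\row_i c i, w))) := euler_x hG.
have := congr1 (fun s => evp s (\row_i c i, w)) G0.
rewrite !evp_sum evp0 evpZ => cG.
have -> : \sum_(i < 2) evp ('X_(xi i) * G^`M(xi i)) (\row_i c i, w) = 0.
  by rewrite -[RHS]cG; apply: eq_bigr => i _; rewrite evpM evpXx evpZ mxE.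
move/esym/eqP; rewrite mulf_eq0; case: a a0 {hG} => // a _.
by rewrite (negPf (char0 a)) => /eqP.
Qed.

(* A linear relation c makes F vanish to order d >= 2 along the line x = c. *)
Lemma Fx_free (c : 'I_2 -> K) : \sum_(i < 2) c i *: Fx i = 0 -> forall i, c i = 0.
Proof.
move=> cF i; apply/eqP/negPn/negP => ci; pose p : pt := (\row_i c i, const_mx 1).
have pi : p.1 ord0 i != 0 by rewrite mxE.
have pj : p.2 ord0 ord0 != 0 by rewrite mxE oner_eq0.
have cF' k : \sum_(i < 2) c i *: F^`M(k)^`M(xi i) = 0.
  transitivity (\sum_(l < 2) c l *: Fx l)^`M(k); last by rewrite cF mderiv0.
  by rewrite linear_sum; apply: eq_bigr => l _; rewrite /= mderivZ mderiv_comm.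
have [] := smooth_at hF hZ pi pj (directional_zero _ d_gt0 hF cF) => /eqP; apply.
  apply: directional_zero (@hFx _) (cF' _); lia.
exact: directional_zero (@hFy _) (cF' _).
Qed.

(** The basis (F_x1, -F_x0): with these coordinates on the target the moving part is the first
    projection on the nose. *)
Definition rotated_grad i : S := - chart_sign K i *: Fx (rev_ord i).

Lemma rotated_grad_basis : is_basis_on F (jacobian F d.-1 e) rotated_grad.
Proof.
split=> [i|t /jacobian_xspan[c ->]|c [q]].
- by apply: jacobianZ; exact: jacobian_Fx.
- exists (fun i => - chart_sign K i * c (rev_ord i)).
  suff -> : \sum_(i < 2) c i *: Fx i =
    \sum_(i < 2) (- chart_sign K i * c (rev_ord i)) *: rotated_grad i by exact:
      eq_on_refl.
  rewrite (sum_ord2 ord0) addrC (sum_ord2 ord0) /rotated_grad !scalerA rev_ordK.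
  by congr (_ *: _ + _ *: _); rewrite mulrAC mulrNN chart_sign_sqr mul1r.
rewrite subr0 => cE.
have hs : bihomog d.-1 e (\sum_(i < 2) c i *: rotated_grad i).
  by apply: bihomog_sum => i _; do 2!apply: bihomogZ; exact: hFx.
(* A relation modulo F is exact here, as no nonzero multiple of F has x-degree d-1. *)
have : \sum_(i < 2) c i *: rotated_grad i = 0.
  rewrite -(bipart_id hs) cE (bipartM _ _ _ hF) [(d <= _)%N]leqNgt.
  by rewrite prednK ?leqnn.
move=> s0 i; have := @Fx_free (fun k => - chart_sign K (rev_ord k) * c (rev_ord k)).
have -> : \sum_(k < 2) (- chart_sign K (rev_ord k) * c (rev_ord k)) *: Fx k = 0.
  rewrite -[RHS]s0 (sum_ord2 ord0) addrC (sum_ord2 ord0) /rotated_grad !scalerA !rev_ordK.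
  by congr (_ *: _ + _ *: _); rewrite mulrC.
move=> /(_ erefl (rev_ord i)); rewrite rev_ordK => /eqP.
by rewrite mulf_eq0 oppr_eq0 (negPf (chart_sign_neq0 _ _)) => /eqP.
Qed.

(** The local equation of D is F_x', and the quotients are the coordinates x_k, after multiplying by
    the unit x_i up to sign. For k = i this is an identity; for the other index the difference is -
    d F by Euler. *)
Lemma rotated_grad_moving_image D p : ramification D -> onZ F p ->
  moving_image F D rotated_grad p p.1.
Proof.
move=> hD pZ; have [i [j [pi pj]]] := onX_chart pZ.1.
exists (- chart_sign K i *: 'X_(xi i)), (Fx (rev_ord i)), (fun k => 'X_(xi k)).
have uE : phi (fun k => 'X_(xi k) : S) p = p.1.
  by apply/rowP => k; rewrite mxE evpXx.
split.
- split; first by exists 1%N, 0%N; apply: bihomogZ; exact: bihomogX.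
  by rewrite evpZ evpXx mulf_neq0 ?oppr_eq0 ?chart_sign_neq0.
- by split; [exists d.-1, e; exact: hFx | exact: (hD p pZ).2].
- by exists 1%N, 0%N => k; exact: bihomogX.
- apply: (@forall_ord2 _ i).
    exists 0; rewrite mul0r /rotated_grad -scalerAl -scalerAr scalerA mulrNN chart_sign_sqr scale1r.
    by rewrite mulrC subrr.
  exists (- d%:R%:MP); rewrite mulNr mul_mpolyC -(euler_x hF) (sum_ord2 i).
  rewrite /rotated_grad rev_ordK -scalerAl -scalerAr scalerA chart_sign_rev opprK mulNr chart_sign_sqr.
  by rewrite scaleN1r; ring.
by rewrite uE; split; [exact: pZ.1.1 | exact: proj_eq_refl].
Qed.

Lemma jacobian_XFx i j : jacobian F d e ('X_(xi i) * Fx j).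
Proof.
split.
  have := bihomogM (@bihomogX _ i) (@hFx j); rewrite add0n add1n prednK //; exact.
exists (fun k => if k == xi j then 'X_(xi i) else 0).
rewrite (bigD1 (xi j)) //= eqxx big1 ?addr0 // => k /negPf->; exact: mul0r.
Qed.

Lemma jacobian_YFy i j : jacobian F d e ('X_(yi i) * Fy j).
Proof.
split.
  have := bihomogM (@bihomogY _ i) (@hFy j); rewrite add0n add1n prednK //; exact.
exists (fun k => if k == yi j then 'X_(yi i) else 0).
rewrite (bigD1 (yi j)) //= eqxx big1 ?addr0 // => k /negPf->; exact: mul0r.
Qed.

Lemma jacobian_bpf : base_point_free F (jacobian F d e).
Proof.
move=> p pZ; have [i [j [pi pj]]] := onX_chart pZ.1.
have [Fxp|Fyp] := smooth_at hF hZ pi pj pZ.2.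
  exists ('X_(xi i) * Fx (rev_ord i)); first exact: jacobian_XFx.
  by rewrite evpM evpXx mulf_neq0.
exists ('X_(yi j) * Fy (rev_ord j)); first exact: jacobian_YFy.
by rewrite evpM evpXy mulf_neq0.
Qed.

(** * Birationality of the map given by J_(d,e) *)

Section Birational.

Variables (n : nat) (s : 'I_n -> S).
Hypothesis hs : is_basis_on F (jacobian F d e) s.

Definition unramified p := [/\ onZ F p, exists i, evp (Fx i) p != 0
                      & exists j, evp (Fy j) p != 0].

(** Makes the inverse algebraic: each x_i F_xj or y_i F_yj becomes a linear form in the target
    coordinates, whichever basis was chosen. *)
Lemma linear_form t : jacobian F d e t -> exists A : {mpoly K[n]},
  A \is 1.-homog /\ forall p, onZ F p -> A.@[phi s p ord0] = evp t p.
Proof.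
case: hs => _ span _ /span[c [q tE]]; exists (\sum_(i < n) c i *: 'X_i); split.
  by apply: rpred_sum => i _; apply: rpredZ; rewrite dhomogX; apply/eqP; exact: mdeg1.
move=> p [_ Fp]; rewrite (raddf_sum (meval (phi s p ord0))) /=.
have := congr1 (fun s => evp s p) tE; rewrite evpB evpM Fp mulr0 evp_sum.
move/eqP; rewrite subr_eq0 => /eqP->; apply: eq_bigr => i _.
by rewrite mevalZ mevalXU evpZ mxE.
Qed.

Lemma XFx_forms : exists A : 'I_2 * 'I_2 -> {mpoly K[n]},
  forall ij, A ij \is 1.-homog /\ forall p, onZ F p ->
    (A ij).@[phi s p ord0] = p.1 ord0 ij.1 * evp (Fx ij.2) p.
Proof.
apply: (@functional_choice _ _ (fun ij (A : {mpoly K[n]}) => A \is 1.-homog /\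
  forall p, onZ F p -> A.@[phi s p ord0] = p.1 ord0 ij.1 * evp (Fx ij.2) p)).
move=> [i j]; have [A [A1 hA]] := linear_form (jacobian_XFx i j).
by exists A; split=> // p pZ; rewrite hA // evpM evpXx.
Qed.

Lemma YFy_forms : exists B : 'I_2 * 'I_2 -> {mpoly K[n]},
  forall ij, B ij \is 1.-homog /\ forall p, onZ F p ->
    (B ij).@[phi s p ord0] = p.2 ord0 ij.1 * evp (Fy ij.2) p.
Proof.
apply: (@functional_choice _ _ (fun ij (A : {mpoly K[n]}) => A \is 1.-homog /\
  forall p, onZ F p -> A.@[phi s p ord0] = p.2 ord0 ij.1 * evp (Fy ij.2) p)).
move=> [i j]; have [A [A1 hA]] := linear_form (jacobian_YFy i j).
by exists A; split=> // p pZ; rewrite hA // evpM evpXy.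
Qed.

Lemma unramified_dense_open : dense_open (@formX K) (onZ F) unramified.
Proof.
split.
  exists (fun f => exists i j, f = evp (Fx i * Fy j)).
    move=> f [i [j ->]]; exists (d.-1 + d)%N, (e + e.-1)%N, (Fx i * Fy j).
    by split=> //; exact: bihomogM (@hFx i) (@hFy j).
  move=> p; split=> [[pZ [i Fxp] [j Fyp]]|[pZ [_ [i [j ->]]]]].
    split=> //; exists (evp (Fx i * Fy j)); first by exists i, j.
    by rewrite evpM mulf_neq0.
  by rewrite evpM mulf_eq0 negb_or => /andP[Fxp Fyp]; split=> //; [exists i|exists j].
move=> f [a [b [g [hg fE]]]] f0 p pZ; rewrite fE.
apply: (generic_dense char0 d_gt0 e_gt0 hF hZ hg) pZ => q qZ Fxq Fyq.
by rewrite -fE f0.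
Qed.

(** Pulling forms back along the map reduces density in the image to density in Z. *)
Lemma evp_comp k (g : {mpoly K[n]}) : g \is k.-homog -> exists2 G : S,
  bihomog (d * k) (e * k) G & forall p, evp G p = g.@[phi s p ord0].
Proof.
move=> /dhomogP hg; exists (mmap (@mpolyC (2 + 2) K) s g).
  rewrite /mmap big_seq; apply: bihomog_sum => m ms; rewrite mul_mpolyC.
  apply: bihomogZ; have <- : mdeg m = k := hg m ms.
  rewrite mdegE; apply: bihomog_prod => i.
  by case: hs => /(_ i)[].
move=> p; rewrite /evp {1}/meval rmorph_mmap; apply: eq_mmap => [c|i] /=.
  exact: mevalC.
by rewrite mxE.
Qed.

Lemma birational : birational_onto_image F s.
Proof.
have [A hA] := XFx_forms; have [B hB] := YFy_forms.
exists unramified, (fun v => exists2 p, unramified p & proj_eq (phi s p) v); split=> //.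
- exact: unramified_dense_open.
- split.
    (* These quadrics pull back to the products x_a F_xb * y_c F_yd, which have a common zero at a
       point of Z exactly when one of the projections ramifies there. *)
    exists (fun f => exists ij kl, f = fun v : 'rV[K]_n => (A ij * B kl).@[v ord0]).
      move=> f [ij [kl ->]]; exists (1 + 1)%N, (A ij * B kl); split=> //.
      by apply: dhomogM; [case: (hA ij) | case: (hB kl)].
    have AB ij kl p c : onZ F p -> (A ij * B kl).@[(c *: phi s p) ord0] =
        c ^+ 2 * ((p.1 ord0 ij.1 * evp (Fx ij.2) p) * (p.2 ord0 kl.1 * evp (Fy kl.2) p)).
      move=> pZ; rewrite mevalM (meval_homogZ _ _ (hA ij).1) (meval_homogZ _ _ (hB kl).1).
      by rewrite (hA ij).2 // (hB kl).2 //; ring.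
    move=> v; split=> [[p [pZ [i Fxp] [j Fyp]] pv]|[[p pZ pv]]].
      split; first by exists p.
      have [k [l [pk pl]]] := onX_chart pZ.1; case: pv => c [c0 ->].
      exists (fun v : 'rV[K]_n => (A (k, i) * B (l, j)).@[v ord0]); first by exists (k,
        i), (l, j).
      by rewrite AB // !mulf_neq0 ?expf_neq0.
    case=> _ [ij [kl ->]]; have [c [c0 vE]] := pv; rewrite vE AB //.
    rewrite !mulf_eq0 !negb_or => /and3P[_ /andP[_ Fxp] /andP[_ Fyp]].
    rewrite -vE; exists p => //; split=> //; [by exists ij.2 | by exists kl.2].
  move=> f [k [g [hg fE]]] f0 v [p pZ [c [c0 ->]]].
  rewrite fE (meval_homogZ _ _ hg); have [G hG GE] := evp_comp hg.
  rewrite -GE (generic_dense char0 d_gt0 e_gt0 hF hZ hG _ pZ) ?mulr0 // => q qZ Fxq Fyq.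
  by rewrite GE -fE f0 //; exists q; [split | exact: proj_eq_refl].
- by move=> p pU; exists p => //; exact: proj_eq_refl.
move=> p [pZ [i Fxp] [j Fyp]]; have [k [l [pk pl]]] := onX_chart pZ.1.
(* On Z this pair is x_k (F_x1, -F_x0), with k chosen so that x_k is nonzero at p. At other points q
   the factor x_k may vanish, but then the pair is zero and nothing is claimed. *)
pose A' m := - chart_sign K m *: A (k, rev_ord m).
pose B' m := - chart_sign K m *: B (l, rev_ord m).
have A'E q : onZ F q -> eval_pair A' (phi s q) =
    \row_m (- chart_sign K m * (q.1 ord0 k * evp (Fx (rev_ord m)) q)).
  by move=> qZ; apply/rowP => m; rewrite !mxE mevalZ (hA _).2.
have B'E q : onZ F q -> eval_pair B' (phi s q) =
    \row_m (- chart_sign K m * (q.2 ord0 l * evp (Fy (rev_ord m)) q)).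
  by move=> qZ; apply/rowP => m; rewrite !mxE mevalZ (hB _).2.
exists 1%N, 1%N, A', B'; split.
- by move=> m; apply: rpredZ; exact: (hA _).1.
- by move=> m; apply: rpredZ; exact: (hB _).1.
- rewrite A'E //; apply/eqP => /rowP/(_ (rev_ord i)); rewrite !mxE rev_ordK => /eqP.
  by rewrite !mulf_eq0 oppr_eq0 (negPf (chart_sign_neq0 _ _)) (negPf pk) (negPf Fxp).
- rewrite B'E //; apply/eqP => /rowP/(_ (rev_ord j)); rewrite !mxE rev_ordK => /eqP.
  by rewrite !mulf_eq0 oppr_eq0 (negPf (chart_sign_neq0 _ _)) (negPf pl) (negPf Fyp).
move=> q [qZ _ _]; rewrite A'E // B'E // => A0 B0; split.
  apply: (proj_eq_gradient (G := fun m => evp (Fx m) q)) A0; last exact: qZ.1.1.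
  have /(congr1 (fun t => evp t q)) := euler_x hF.
  rewrite evpZ qZ.2 mulr0 evp_sum => qE; apply: etrans qE.
  by apply: eq_bigr => m _; rewrite evpM evpXx.
apply: (proj_eq_gradient (G := fun m => evp (Fy m) q)) B0; last exact: qZ.1.2.
have /(congr1 (fun t => evp t q)) := euler_y hF.
rewrite evpZ qZ.2 mulr0 evp_sum => qE; apply: etrans qE.
by apply: eq_bigr => m _; rewrite evpM evpXy.
Qed.

End Birational.

End Main.

Theorem theorem4p2 (R : realType) (d e : nat) (F : {mpoly R[i]%C[2 + 2]})
    (hd : (2 <= d)%N) (he : (2 <= e)%N)
    (hF : bihomog d e F) (hZ : smooth F) :
  ((exists2 D : 'rV[R[i]%C]_2 * 'rV[R[i]%C]_2 -> nat,
       is_base_divisor F (jacobian F d.-1 e) D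
     & is_ramification_divisor2 F D)
   /\ induces_projection1 F (jacobian F d.-1 e))
  /\
  (base_point_free F (jacobian F d e)
   /\ forall (n : nat) (s : 'I_n -> {mpoly R[i]%C[2 + 2]}),
        is_basis_on F (jacobian F d e) s -> birational_onto_image F s).
Proof.
have char0 n : n.+1%:R != 0 :> R[i]%C by rewrite Num.Theory.pnatr_eq0.
have [D hD] := ramification_exists char0 hd he hF hZ.
split; split.
- exists D; first exact: (ramification_base char0 hd he hF hZ hD).
  exact: (ramification_ram char0 hd he hF hZ hD).
- exists D, (@rotated_grad _ F); split.
  + exact: (ramification_base char0 hd he hF hZ hD).
  + exact: (rotated_grad_basis char0 hd he hF hZ).
  by move=> p pZ; apply: (rotated_grad_moving_image _ hD pZ); exact: hF.
- exact: (jacobian_bpf hd he hF hZ).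
by move=> n s hs; exact: (birational char0 hd he hF hZ hs).
Qed.
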